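(* For integers $n,b\geq 1$, $k\geq 0$ and $m_1,\ldots,m_n \geq b$, the number of $(k+1)$-tuples of tight $b$-decorated trees (each coding for a $0$-slice) having in total $n$ blossoming vertices, numbered from $1$ to $n$, of respective degrees $2m_1,\ldots,2m_n$, where the first tree contains the blossoming vertex numbered $1$ (of degree $2m_1$), is equal to $$F^{(b)}_k(m_1,\ldots,m_n) := (n-1)! \sum_{k_1,\ldots,k_n \geq 0} q^{(b)}_{k_1}(m_1) \cdots q^{(b)}_{k_n}(m_n)\, \alpha^{(b)}_{k+k_1+\cdots+k_n,n-1}$$ with $$\alpha_{k,n}^{(b)} = [u^{n-k}] \frac{1}{\left( 1 - u \sum_{j=2}^b \frac1 b \binom{b}{j} \binom{b}{j-1} (-u)^{j-2} \right)^{n+1}}$$ and $$q^{(b)}_{k}(m) := \binom{m+b}{k} \binom{m-b-1+k}{k} = \frac1{(k!)^2} \prod_{i=0}^{k-1} \left( m^2 - (b-i)^2 \right).$$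
   Context: Let $b\ge1$. A $b$-decorated tree is a finite plane tree such that: - It has three types of vertices: primal, dual and edge-vertices, connected by primal half-edges (joining a primal vertex to an edge-vertex) or dual half-edges (joining a dual vertex to an edge-vertex). - It carries arrows, in number between $1$ and $b$, on all primal half-edges incident to a primal vertex of degree at least two, pointing away from that vertex (other half-edges carry no arrow); and leaflets (dangling half-edges), incident to dual vertices and contributing to their degrees. - Around each primal vertex of degree at least two, the total number of arrows is $b+1$. - It is planted on an edge-vertex of degree one, the root; all other edge-vertices have degree two. - An edge-vertex incident to two primal half-edges has both half-edges carrying arrows, with $b$ arrows in total. - An edge-vertex incident to two dual half-edges may exist only when $b=1$, and exactly one of its adjacent dual vertices has degree $2b=2$. - An edge-vertex incident to one primal and one dual half-edge (bent edge-vertex) is of one of the following types: a twig-vertex: the primal half-edge carries no arrow, hence leads to a primal vertex of degree one (the twig-vertex, its incident half-edges and the adjacent primal vertex form a twig); a special bent edge-vertex: the primal half-edge carries $b-1$ arrows and the adjacent dual vertex has degree $2b$; a regular bent edge-vertex: the primal half-edge carries $b$ arrows and the adjacent dual vertex has degree at least $2b+2$. - Each dual vertex of degree $2b$ (special) is incident to exactly one dual half-edge and $2b-1$ leaflets. - Every other dual vertex (labeled) has even degree $2m$ with $m\ge b+1$, and is adjacent to exactly $m-b-1$ twig-vertices. The trees coding for $0$-slices are those whose root edge-vertex is incident to a primal half-edge carrying $b$ arrows, together with, when $b=1$, the tree consisting of the root edge-vertex joined by a dual half-edge to a special dual vertex of degree $2$ carrying one leaflet (it codes for the $2$-angle slice).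 The blossoming vertices are the dual vertices. The root of a blossoming vertex is its dual half-edge leading towards the root of the tree; its decorations are its other incident half-edges: leaflets, twigs, or attaching points (the dual half-edges leading to its other children). A $b$-decorated tree is tight if, at each blossoming vertex, the sequence of decorations read in clockwise order from its root does not contain a twig followed immediately by a leaflet. $[u^j]$ denotes coefficient extraction (zero for $j<0$); hence $\alpha^{(b)}_{k,n}=0$ for $k>n$ and the sum is finite. The binomials in $q_k^{(b)}$ are $\binom{a}{k}=a(a-1)\cdots(a-k+1)/k!$. *)

(* Defs.v *)
From mathcomp Require Import all_boot all_order all_algebra.
From mathcomp Require Import classical_sets functions cardinality fsbigop.

Set Implicit Arguments.
Unset Strict Implicit.
Unset Printing Implicit Defensive.

Import GRing.Theory.
Local Open Scope ring_scope.

(* A term of type [tree L] is what hangs from an edge-vertex: a half-edge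
   together with everything beyond it.  A planted tree is the term hanging from
   its root edge-vertex, which is left implicit.  The other edge-vertices have
   degree two, hence they are the parent-child pairs of constructors.

   [Primal a cs]: a primal half-edge carrying [a] arrows, leading to a primal
   vertex; a pair [(a', t)] in [cs] is another half-edge of that vertex,
   carrying [a'] arrows, leading to the edge-vertex from which [t] hangs.

   [Dual l ds]: a dual half-edge leading to a dual vertex bearing the number
   [l]; in [ds], [None] is a leaflet and [Some t] a dual half-edge leading to
   the edge-vertex from which [t] hangs.

   The half-edges in [cs] and [ds] are listed in clockwise order around the
   vertex, starting from the half-edge that leads towards the root.  Only
   primal half-edges may carry arrows. *)
Inductive tree (L : Type) : Type :=
| Primal of nat & seq (nat * tree L)
| Dual of L & seq (option (tree L)).

Arguments Primal {L}.

(* A half-edge seen from its edge-vertex: its number of arrows if it is primal,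
   the degree (leaflets included) of its dual vertex if it is dual. *)
Inductive half_edge := PrimalHalf of nat | DualHalf of nat.

Definition top_half (L : Type) (t : tree L) : half_edge :=
  match t with
  | Primal a _ => PrimalHalf a
  | Dual _ ds => DualHalf (size ds).+1
  end.

Definition is_leaflet (L : Type) (d : option (tree L)) : bool :=
  if d is None then true else false.

Definition is_twig (L : Type) (d : option (tree L)) : bool :=
  if d is Some (Primal 0 _) then true else false.

(* [arrows] lists the number of arrows on each half-edge of the vertex. *)
Definition primal_ok (b : nat) (arrows : seq nat) : bool :=
  (if size arrows == 1 then arrows == [:: 0]
   else all (fun a => 1 <= a <= b) arrows && (sumn arrows == b.+1))%N.

(* In the bent case, the three disjuncts are the twig-vertices, the special and
   the regular bent edge-vertices. *)
Definition edge_ok (b : nat) (h1 h2 : half_edge) : bool :=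
  match h1, h2 with
  | PrimalHalf a1, PrimalHalf a2 => [&& 0 < a1, 0 < a2 & a1 + a2 == b]%N
  | DualHalf d1, DualHalf d2 =>
      ((b == 1) && ((d1 == 2 * b) (+) (d2 == 2 * b)))%N
  | PrimalHalf a, DualHalf d | DualHalf d, PrimalHalf a =>
      [|| a == 0, (a == b - 1) && (d == 2 * b) |
          (a == b) && (2 * b + 2 <= d)]%N
  end.

(* The half-edge towards the root, not listed in [ds], is dual and does not lead
   to a twig-vertex, since the primal vertex of a twig has degree one. *)
Definition dual_ok (L : Type) (b : nat) (ds : seq (option (tree L))) : bool :=
  let d := (size ds).+1 in
  (if d == 2 * b then all (@is_leaflet L) ds
   else [&& ~~ odd d, b.+1 <= d./2
          & count (@is_twig L) ds == d./2 - b.+1])%N.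

Fixpoint decorated (L : Type) (b : nat) (t : tree L) : bool :=
  match t with
  | Primal a cs =>
      primal_ok b (a :: [seq c.1 | c <- cs]) &&
      all (fun c => edge_ok b (PrimalHalf c.1) (top_half c.2)
                    && decorated b c.2) cs
  | Dual _ ds =>
      dual_ok b ds &&
      all (fun d => if d is Some t'
                    then edge_ok b (DualHalf (size ds).+1) (top_half t')
                         && decorated b t'
                    else true) ds
  end.

Definition codes_0slice (L : Type) (b : nat) (t : tree L) : bool :=
  match t with
  | Primal a _ => a == b
  | Dual _ [:: None] => b == 1%N
  | Dual _ _ => false
  end.

Fixpoint tight (L : Type) (t : tree L) : bool :=
  match t with
  | Primal _ cs => all (fun c => tight c.2) cs
  | Dual _ ds =>
      sorted (fun x y => ~~ (is_twig x && is_leaflet y)) ds &&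
      all (fun d => if d is Some t' then tight t' else true) ds
  end.

(* The numbers and degrees of the blossoming vertices. *)
Fixpoint blossoms (L : Type) (t : tree L) : seq (L * nat) :=
  match t with
  | Primal _ cs => flatten [seq blossoms c.2 | c <- cs]
  | Dual l ds =>
      (l, (size ds).+1) ::
      flatten [seq (if d is Some t' then blossoms t' else [::]) | d <- ds]
  end.

(* The index [i] of ['I_n] stands for the number i + 1. *)
Definition slice_forest (b k n : nat) (m : 'I_n -> nat)
    (ts : k.+1.-tuple (tree 'I_n)) : Prop :=
  [/\ all (fun t => [&& decorated b t, codes_0slice b t & tight t]) ts,
      perm_eq (flatten [seq blossoms t | t <- ts])
              [seq (i, (2 * m i)%N) | i <- enum 'I_n]
    & has (fun x => val x.1 == 0%N) (blossoms (thead ts))].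

Definition binom (a : rat) (k : nat) : rat :=
  (\prod_(i < k) (a - i%:R)) / k`!%:R.

Definition q (b k : nat) (m : rat) : rat :=
  binom (m + b%:R) k * binom (m - b%:R - 1 + k%:R) k.

(* The first [n] coefficients of the formal power series [1 / p], obtained by
   solving [p * (1 / p) = 1] degree by degree; see [inv_coefP]. *)
Fixpoint inv_coefs (p : {poly rat}) (n : nat) : seq rat :=
  if n is n'.+1 then
    let s := inv_coefs p n' in
    rcons s (((n' == 0%N)%:R - \sum_(i < n') p`_(n' - i) * s`_i) / p`_0)
  else [::].

Definition inv_coef (p : {poly rat}) (j : nat) : rat := (inv_coefs p j.+1)`_j.

Lemma size_inv_coefs (p : {poly rat}) n : size (inv_coefs p n) = n.
Proof. by elim: n => //= n IHn; rewrite size_rcons IHn. Qed.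

Lemma nth_inv_coefs (p : {poly rat}) n j : (j < n)%N -> (inv_coefs p n)`_j = inv_coef p j.
Proof.
elim: n => // n IHn; rewrite ltnS leq_eqVlt => /orP[/eqP-> //|jn].
by rewrite /= nth_rcons size_inv_coefs jn IHn.
Qed.

Lemma inv_coefP (p : {poly rat}) j : p`_0 != 0 ->
  \sum_(i < j.+1) p`_(j - i) * inv_coef p i = (j == 0%N)%:R.
Proof.
move=> p0; rewrite big_ord_recr /= subnn {2}/inv_coef /=.
rewrite nth_rcons size_inv_coefs ltnn eqxx mulrC divfK //.
rewrite [X in _ - X](eq_bigr (fun i : 'I_j => p`_(j - i) * inv_coef p i)).
  by rewrite addrC subrK.
by move=> i _; rewrite nth_inv_coefs.
Qed.

Definition alpha_den (b : nat) : {poly rat} :=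
  1 - 'X * \sum_(2 <= j < b.+1)
             (b%:R^-1 * 'C(b, j)%:R * 'C(b, j.-1)%:R) *: (- 'X) ^+ (j - 2).

Definition alpha (b k n : nat) : rat :=
  if (k <= n)%N then inv_coef (alpha_den b ^+ n.+1) (n - k) else 0.

Lemma alpha_den_coef0 b n : (alpha_den b ^+ n)`_0 = 1.
Proof.
rewrite -horner_coef0 horner_exp /alpha_den hornerD hornerN hornerM hornerX.
by rewrite mul0r oppr0 addr0 hornerC expr1n.
Qed.

(* The sum over [{ffun 'I_n -> nat}] is a sum over its finite support, as
   [alpha] vanishes when the [ks i] are large. *)
Definition F (b k n : nat) (m : 'I_n -> nat) : rat :=
  (n.-1)`!%:R *
  \sum_(ks \in [set: {ffun 'I_n -> nat}])
     (\prod_(i < n) q b (ks i) (m i)%:R) *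
     alpha b (k + \sum_(i < n) ks i)%N n.-1.

Arguments F : clear implicits.

(* Main.v *)
Require Import Defs.
From HB Require Import structures.
From mathcomp Require Import all_boot all_order all_algebra.
From mathcomp Require boolp.
From mathcomp Require Import ring zify.

Set Implicit Arguments.
Unset Strict Implicit.
Unset Printing Implicit Defensive.

Import GRing.Theory Num.Theory.
Local Open Scope ring_scope.

(* Give the blossoming vertex numbered [l] the weight [t_l], where [t_l ^ 2 = 0], and let [R], [S], [D]
   be the generating functions of the trees coding for 0-slices, of the special and of the labeled dual
   vertices (with everything beyond them).  Two equations determine [R].

   Around a labeled dual vertex of degree [2 m] there are [m + b] leaflets or attaching points and
   [m - b - 1] twigs, and a twig may only precede an attaching point or end the sequence; so there are
   [q_k(m)] tight sequences with [k] attaching points, and [S + D = sum_l t_l sum_k q_k(m_l) R ^ k].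

   Around a primal vertex the arrows form a composition of [b + 1].  With [y_a] the generating function
   of what lies beyond a half-edge with [a] arrows (plus [S] if [a = b], so that [y_b = S + D]), this
   amounts to [y = x (R + y) (1 - y)] up to degree [b] in [x].  Lagrange inversion extracts [y_b], a
   Narayana polynomial in [R], and gives [S + D = R alpha_den(R)].

   Hence [R = sum_l t_l Q_l(R) / alpha_den(R)], and multilinear Lagrange inversion yields the coefficient
   of [t_1 ... t_n] in [R ^ (k + 1)].  Requiring the vertex numbered 1 to lie in the first tree divides it
   by [k + 1], since marking that vertex is a derivation. *)

(** * Multilinear series *)

(* The algebra [K[t_i | i in I] / (t_i ^ 2)]: the value at [A] is the coefficient of the product of the
   [t_i] for [i] in [A]. *)
Definition mls (I : finType) (K : comNzRingType) := {ffun {set I} -> K}.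

HB.instance Definition _ (I : finType) (K : comNzRingType) :=
  GRing.Zmodule.copy (mls I K) {ffun {set I} -> K}.

Section MlsRing.
Variables (I : finType) (K : comNzRingType).
Implicit Types (f g h : mls I K) (A B C : {set I}).

Definition mls_const (c : K) : mls I K := [ffun A => if A == set0 then c else 0].

Definition mls_mul f g : mls I K :=
  [ffun A : {set I} => \sum_(B : {set I} | B \subset A) f B * g (A :\: B)].

Lemma mls_mulC : commutative mls_mul.
Proof.
move=> f g; apply/ffunP=> A; rewrite !ffunE.
rewrite (reindex_onto (fun B => A :\: B) (fun B => A :\: B)) /=; last first.
  by move=> B BA; rewrite setDDr setDv set0U; apply/setIidPr.
apply: eq_big => [B|B].
  rewrite subsetDl /= setDDr setDv set0U.
  by apply/eqP/idP => [<-|BA]; [rewrite subsetIl|apply/setIidPr].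
by case/andP=> _ /eqP ->; rewrite mulrC.
Qed.

Lemma mls_mulA : associative mls_mul.
Proof.
move=> f g h; apply/ffunP=> A; rewrite !ffunE.
under eq_bigr => B BA do rewrite ffunE big_distrr /=.
under [RHS]eq_bigr => B BA do rewrite ffunE big_distrl /=.
rewrite [RHS](exchange_big_dep (fun C : {set I} => C \subset A)) /=; last first.
  by move=> B C BA CB; apply: subset_trans CB BA.
apply: eq_bigr => B BA.
rewrite [RHS](reindex_onto (fun C => B :|: C) (fun C => C :\: B)) /=; last first.
  by move=> E /andP[_ BE]; apply/setP=> x; rewrite !inE; case xB: (x \in B) => //=; rewrite (subsetP BE).
have UD C : ((B :|: C) :\: B == C) = [disjoint C & B].
  by rewrite setDUl setDv set0U; apply/eqP/setDidPl.
apply: eq_big => [C|C].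
  by rewrite subUset BA subsetUl andbT UD subsetD.
by rewrite subsetD -UD => /andP[_ /eqP ->]; rewrite mulrA setDDl.
Qed.

Lemma mls_mul1 : left_id (mls_const 1) mls_mul.
Proof.
move=> f; apply/ffunP=> A; rewrite !ffunE (bigD1 set0) ?sub0set //= ffunE eqxx mul1r setD0.
rewrite big1 ?addr0 // => B /andP[_ /negbTE B0]; by rewrite ffunE B0 mul0r.
Qed.

Lemma mls_mulDl : left_distributive mls_mul +%R.
Proof.
move=> f g h; apply/ffunP=> A; rewrite !ffunE -big_split; apply: eq_bigr => B _.
by rewrite ffunE mulrDl.
Qed.

Lemma mls_1_neq0 : mls_const 1 != 0.
Proof.
by apply/eqP => /ffunP /(_ set0); rewrite !ffunE eqxx; apply/eqP/oner_neq0.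
Qed.

HB.instance Definition _ := GRing.Zmodule_isComNzRing.Build (mls I K)
  mls_mulA mls_mulC mls_mul1 mls_mulDl mls_1_neq0.

Lemma mlsM f g A : (f * g) A = \sum_(B : {set I} | B \subset A) f B * g (A :\: B).
Proof. by rewrite ffunE. Qed.

Lemma mlsD f g A : (f + g) A = f A + g A.
Proof. by rewrite ffunE. Qed.

Lemma mlsB f g A : (f - g) A = f A - g A.
Proof. by rewrite !ffunE. Qed.

Lemma mlsMn f k A : (f *+ k) A = f A *+ k.
Proof. by elim: k => [|k IHk]; rewrite ?mulr0n ?ffunE // !mulrS mlsD IHk. Qed.

Lemma mls1 A : (1 : mls I K) A = (A == set0)%:R.
Proof. by rewrite ffunE; case: eqP. Qed.

Lemma mls_const_is_zmod : zmod_morphism mls_const.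
Proof. by move=> c d; apply/ffunP=> A; rewrite !ffunE; case: eqP; rewrite ?subr0. Qed.

Lemma mls_const_mulE c f A : (mls_const c * f) A = c * f A.
Proof.
rewrite mlsM (bigD1 set0) ?sub0set //= ffunE eqxx setD0.
rewrite big1 ?addr0 // => B /andP[_ /negbTE B0]; by rewrite ffunE B0 mul0r.
Qed.

Lemma mls_const_is_monoid : monoid_morphism mls_const.
Proof.
split=> // c d; apply/ffunP=> A; rewrite mls_const_mulE !ffunE.
by case: eqP; rewrite ?mulr0.
Qed.

HB.instance Definition _ := GRing.isZmodMorphism.Build K (mls I K) mls_const mls_const_is_zmod.
HB.instance Definition _ := GRing.isMonoidMorphism.Build K (mls I K) mls_const mls_const_is_monoid.

Definition mlsX (i : I) : mls I K := [ffun A => (A == [set i])%:R].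

Lemma mlsX_mulE i f A : (mlsX i * f) A = if i \in A then f (A :\ i) else 0.
Proof.
rewrite mlsM; case: ifP => iA.
  rewrite (bigD1 [set i]) ?sub1set //= ffunE eqxx mul1r.
  by rewrite big1 ?addr0 // => B /andP[_ /negbTE Bi]; rewrite ffunE Bi mul0r.
rewrite big1 // => B BA; rewrite ffunE; case: eqP => [Bi|]; last by rewrite mul0r.
by move: BA; rewrite Bi sub1set iA.
Qed.

Lemma mls_coef_sum (J : Type) (r : seq J) (P : pred J) (F : J -> mls I K) A :
  (\sum_(j <- r | P j) F j) A = \sum_(j <- r | P j) F j A.
Proof. by elim/big_rec2: _ => [|j x y _ <-]; rewrite ffunE. Qed.

Lemma mlsM_split i f g A : i \notin A ->
  (f * g) (i |: A) =
  \sum_(B : {set I} | B \subset A) (f (i |: B) * g (A :\: B) + f B * g (i |: (A :\: B))).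
Proof.
move=> iA; rewrite mlsM big_split /= (bigID (fun B => i \in B)) /=; congr (_ + _).
  rewrite (reindex_onto (fun B => i |: B) (fun B => B :\ i)) /=; last first.
    by move=> B /andP[_ iB]; rewrite setD1K.
  have UD B : ((i |: B) :\ i == B) = (i \notin B).
    apply/eqP/idP => [<-|/setU1K //]; by rewrite !inE eqxx.
  have e B : (i |: B \subset i |: A) && (i \in i |: B) && ((i |: B) :\ i == B)
             = (B \subset A).
    rewrite UD setU11 andbT; apply/andP/idP => [[BA iB]|BA].
      apply/subsetP=> x xB; have := subsetP BA x; rewrite !inE xB orbT.
      move=> /(_ isT) /orP[/eqP xi|//]; by rewrite -xi xB in iB.
    by rewrite setUS //; split => //; apply: contra iA => /(subsetP BA).
  apply: eq_big => // B; rewrite e => BA.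
  congr (_ * g _); apply/setP=> x; rewrite !inE; case: eqP => //= ->.
  by rewrite (negbTE iA) andbF.
apply: eq_big => [B|B /andP[BA iB]].
  apply/andP/idP => [[BA iB]|BA].
    apply/subsetP=> x xB; have := subsetP BA x xB; rewrite !inE.
    by case/orP=> [/eqP xi|//]; rewrite -xi xB in iB.
  split; first by apply: subset_trans BA (subsetU1 _ _).
  by apply: contra iA => /(subsetP BA).
congr (_ * g _); apply/setP=> x; rewrite !inE; case: eqP => //= ->.
by rewrite iB.
Qed.
End MlsRing.
Arguments mls_const I {K} c.
Arguments mlsX {I} K i.

(** Congruence modulo the products of more than [s] variables. *)
Definition mls_eqle (I : finType) (K : comNzRingType) (s : nat) (f g : mls I K) :=
  forall A : {set I}, (#|A| <= s)%N -> f A = g A.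

Section Truncation.
Variables (I : finType) (K : comNzRingType).
Implicit Types f g h : mls I K.

Lemma mls_eqleM s f f' g g' :
  mls_eqle s f f' -> mls_eqle s g g' -> mls_eqle s (f * g) (f' * g').
Proof.
move=> ff gg A As; rewrite !mlsM; apply: eq_bigr => B BA.
rewrite ff ?gg //; first by apply: leq_trans As; apply: subset_leq_card (subsetDl _ _).
by apply: leq_trans As; apply: subset_leq_card.
Qed.

Definition mls_eval (R : mls I K) (p : {poly K}) : mls I K :=
  (map_poly (mls_const I) p).[R].

Lemma mls_eval_is_zmod R : zmod_morphism (mls_eval R).
Proof. by move=> p r; rewrite /mls_eval rmorphB hornerD hornerN. Qed.

Lemma mls_eval_is_monoid R : monoid_morphism (mls_eval R).
Proof.
by split=> [|p r]; rewrite /mls_eval ?rmorph1 ?hornerC // rmorphM hornerM.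
Qed.

HB.instance Definition _ (R : mls I K) := GRing.isZmodMorphism.Build {poly K} (mls I K)
  (mls_eval R) (mls_eval_is_zmod R).
HB.instance Definition _ (R : mls I K) := GRing.isMonoidMorphism.Build {poly K} (mls I K)
  (mls_eval R) (mls_eval_is_monoid R).

Lemma mls_evalX R : mls_eval R 'X = R.
Proof. by rewrite /mls_eval map_polyX hornerX. Qed.

Lemma mls_evalC R c : mls_eval R c%:P = mls_const I c.
Proof. by rewrite /mls_eval map_polyC hornerC. Qed.

Lemma mls_eval_ind (h : {rmorphism {poly K} -> mls I K}) :
  (forall c, h c%:P = mls_const I c) -> forall p, h p = mls_eval (h 'X) p.
Proof.
move=> hC; elim/poly_ind => [|p c IHp]; first by rewrite !rmorph0.
by rewrite !rmorphD !rmorphM /= IHp hC mls_evalX mls_evalC.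
Qed.

Lemma mls_eval_eqle s R R' p :
  mls_eqle s R R' -> mls_eqle s (mls_eval R p) (mls_eval R' p).
Proof.
move=> RR; elim/poly_ind: p => [|p c IHp]; first by rewrite !rmorph0.
move=> A As; rewrite !rmorphD !rmorphM /= !mls_evalX !mls_evalC.
by rewrite !mlsD (mls_eqleM IHp RR).
Qed.

(** Each factor [t_i] raises the degree by one, so agreement up to degree [s] propagates to degree
    [s + 1]. *)
Lemma mls_fixpoint_unique (P : I -> {poly K}) R R' :
  R = \sum_i mlsX K i * mls_eval R (P i) ->
  R' = \sum_i mlsX K i * mls_eval R' (P i) -> R = R'.
Proof.
move=> RE RE'; suff E s : mls_eqle s R R'.
  by apply/ffunP=> A; apply: (E #|A|).
elim: s => [|s IHs] A As.
  rewrite RE RE' !mls_coef_sum; apply: eq_bigr => i _; rewrite !mlsX_mulE.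
  by move: As; rewrite leqn0 cards_eq0 => /eqP->; rewrite inE.
rewrite RE RE' !mls_coef_sum; apply: eq_bigr => i _; rewrite !mlsX_mulE.
case: ifP => // iA; apply: (mls_eval_eqle _ IHs).
by move: As; rewrite (cardsD1 i) iA.
Qed.
End Truncation.

(** * Lagrange inversion *)

Lemma deriv_prod (K : comNzRingType) (J : finType) (A : {set J}) (F : J -> {poly K}) :
  (\prod_(i in A) F i)^`() = \sum_(i in A) (F i)^`() * \prod_(j in A :\ i) F j.
Proof.
elim: {A}#|A| {-2}A (erefl #|A|) => [|s IHs] A As.
  by rewrite (cards0_eq As) !big_set0 derivC.
have [i iA] : exists i, i \in A by apply/set0Pn; rewrite -card_gt0 As.
rewrite [in LHS](big_setD1 i) // derivM (big_setD1 i iA) IHs; last first.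
  by move: As; rewrite (cardsD1 i A) iA => -[].
congr (_ + _); rewrite big_distrr; apply: eq_bigr => j; rewrite !inE => /andP[ji jA].
rewrite [in RHS](big_setD1 i) ?inE 1?eq_sym ?ji //= mulrCA; congr (_ * (_ * _)).
by apply: eq_bigl => x; rewrite !inE andbCA.
Qed.

Section Lagrange.
Variables (I : finType) (K : comNzRingType) (P : I -> {poly K}).
Implicit Types (A B : {set I}) (F G H : {poly K}).

(* If [R = x + sum_i t_i P_i(R)], then [lagL G = G(R)] and [lagM F = F(R) dR/dx], as series in the [t_i]
   whose coefficients are polynomials in [x]. *)
Definition lagM F : mls I {poly K} := [ffun A : {set I} => (F * \prod_(i in A) P i)^`(#|A|)].
Definition lagL G : mls I {poly K} := [ffun A : {set I} =>
  if A == set0 then G else (G^`() * \prod_(i in A) P i)^`(#|A|.-1)].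

(** With R_x the derivative of R in x, the derivative of R in t_i is P_i(R) R_x; hence that of F(R)
    R_x in t_i is the derivative in x of F(R) P_i(R) R_x. *)
Lemma lagM_setU1 F i A : i \notin A -> lagM F (i |: A) = (lagM (F * P i) A)^`().
Proof. by move=> iA; rewrite !ffunE cardsU1 iA big_setU1 //= mulrA. Qed.

(** Likewise the derivative of G(R) in t_i is G'(R) P_i(R) R_x. *)
Lemma lagL_setU1 G i A : i \notin A -> lagL G (i |: A) = lagM (G^`() * P i) A.
Proof.
move=> iA; rewrite !ffunE cardsU1 iA big_setU1 //= mulrA.
by rewrite -cards_eq0 cardsU1 iA.
Qed.

Lemma lagL_deriv G A : (lagL G A)^`() = lagM G^`() A.
Proof.
rewrite !ffunE -cards_eq0; case: eqP => [A0|/eqP]; last first.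
  by rewrite -lt0n => /prednK {2}<-; rewrite derivnS.
by rewrite A0 (cards0_eq A0) big_set0 mulr1.
Qed.

(** Induction on the degree, differentiating both sides in some [t_i]. Treating all degrees up to
    [s] at once allows the hypothesis to be used inside products. *)
Lemma lagM_eqle s G H : mls_eqle s (lagL G * lagM H) (lagM (G * H)).
Proof.
elim: s G H => [|s IHs] G H A As.
  move: As; rewrite leqn0 cards_eq0 => /eqP->.
  rewrite mlsM (bigD1 set0) ?sub0set //= setD0 big1 ?addr0; last first.
    by move=> B; rewrite subset0; case: eqP.
  by rewrite !ffunE eqxx cards0 big_set0 !mulr1.
have [->|[i iA]] := set_0Vmem A; first by apply: IHs; rewrite cards0.
rewrite -(setD1K iA); set A' := A :\ i.
have iA' : i \notin A' by rewrite !inE eqxx.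
have As' : (#|A'| <= s)%N by move: As; rewrite (cardsD1 i) iA.
have iB B : B \subset A' -> i \notin B by move=> BA; apply: contra iA' => /(subsetP BA).
rewrite mlsM_split //.
(* The product rule in x isolates a total derivative, which the induction hypothesis matches with
   the right-hand side; the other two products must cancel. *)
transitivity (\sum_(B : {set I} | B \subset A')
   (lagM (G^`() * P i) B * lagM H (A' :\: B) - lagM G^`() B * lagM (H * P i) (A' :\: B)
    + (lagL G B * lagM (H * P i) (A' :\: B))^`())).
  apply: eq_bigr => B BA; rewrite lagL_setU1 ?iB // lagM_setU1; last first.
    by rewrite iB // subsetDl.
  by rewrite derivM lagL_deriv; ring.
rewrite big_split sumrB /= -!mlsM -(raddf_sum (@deriv K)) -mlsM.
rewrite (IHs G (H * P i) A' As') /= (mulrA G) -lagM_setU1 //.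
(* Both products stand for P_i(R) G'(R) H(R) R_x ^ 2: the hypothesis pulls P_i(R) out of either
   [lagM]. *)
suff -> : (lagM (G^`() * P i) * lagM H) A' = (lagM G^`() * lagM (H * P i)) A'.
  by rewrite subrr add0r.
have e1 : mls_eqle s (lagM (G^`() * P i) * lagM H) (lagL (P i) * lagM G^`() * lagM H).
  by apply: mls_eqleM => // B Bs; rewrite mulrC -IHs.
have e2 : mls_eqle s (lagM G^`() * lagM (H * P i)) (lagM G^`() * (lagL (P i) * lagM H)).
  by apply: mls_eqleM => // B Bs; rewrite mulrC -IHs.
by rewrite e1 // e2 // mulrCA mulrA.
Qed.

Lemma lagL_mulM G H : lagL G * lagM H = lagM (G * H).
Proof. by apply/ffunP=> A; apply: (@lagM_eqle #|A|). Qed.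

Lemma lagL_is_zmod : zmod_morphism lagL.
Proof.
move=> G H; apply/ffunP=> A; rewrite !ffunE; case: eqP => // _.
by rewrite derivB mulrBl derivnB.
Qed.

Lemma lagLC c : lagL c%:P = mls_const I c%:P.
Proof.
by apply/ffunP=> A; rewrite !ffunE; case: eqP => // _; rewrite derivC mul0r derivnC if_same.
Qed.

(** Away from the constant term, compare derivatives in some [t_i]: [lagL_mulM] absorbs the
    undifferentiated factor, and the product rule for G H remains. *)
Lemma lagL_is_monoid : monoid_morphism lagL.
Proof.
split=> [|G H]; first by rewrite lagLC.
apply/ffunP=> A; have [->|[i iA]] := set_0Vmem A.
  rewrite mlsM (bigD1 set0) ?sub0set //= setD0 big1 ?addr0 ?ffunE ?eqxx //.
  by move=> B; rewrite subset0; case: eqP.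
rewrite -(setD1K iA); set A' := A :\ i.
have iA' : i \notin A' by rewrite !inE eqxx.
have iB B : B \subset A' -> i \notin B by move=> BA; apply: contra iA' => /(subsetP BA).
rewrite mlsM_split // lagL_setU1 //.
under eq_bigr => B BA.
  rewrite lagL_setU1 ?iB // lagL_setU1; last by rewrite iB // subsetDl.
over.
rewrite big_split /= -!mlsM [lagM _ * _]mulrC !lagL_mulM.
have -> : (G * H)^`() * P i = H * (G^`() * P i) + G * (H^`() * P i) by rewrite derivM; ring.
by rewrite !ffunE mulrDl derivnD.
Qed.

HB.instance Definition _ := GRing.isZmodMorphism.Build {poly K} (mls I {poly K}) lagL lagL_is_zmod.
HB.instance Definition _ := GRing.isMonoidMorphism.Build {poly K} (mls I {poly K}) lagL lagL_is_monoid.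

(** Setting x = 0 turns R = x + sum_i t_i P_i(R) into the equation of interest. *)
Definition lag0 G : mls I K := [ffun A => (lagL G A).[0]].

Lemma lag0_is_zmod : zmod_morphism lag0.
Proof.
move=> G H; apply/ffunP=> A; rewrite [LHS]ffunE rmorphB !mlsB.
by rewrite hornerD hornerN [lag0 G A]ffunE [lag0 H A]ffunE.
Qed.

Lemma lag0_is_monoid : monoid_morphism lag0.
Proof.
split=> [|G H]; apply/ffunP=> A.
  by rewrite [LHS]ffunE rmorph1 !mls1; case: eqP; rewrite ?hornerC ?horner0.
rewrite [LHS]ffunE rmorphM !mlsM horner_sum; apply: eq_bigr => B _.
by rewrite hornerM !ffunE.
Qed.

HB.instance Definition _ := GRing.isZmodMorphism.Build {poly K} (mls I K) lag0 lag0_is_zmod.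
HB.instance Definition _ := GRing.isMonoidMorphism.Build {poly K} (mls I K) lag0 lag0_is_monoid.

Lemma lag0_eval G : lag0 G = mls_eval (lag0 'X) G.
Proof.
apply: mls_eval_ind => c; apply/ffunP=> A; rewrite ffunE lagLC !ffunE.
by case: eqP; rewrite ?hornerC ?horner0.
Qed.

(** On a nonempty [A] the explicit coefficients match after one differentiation of the product of
    the P_i is carried out, which lowers the order from |A| - 1 to |A| - 2. *)
Lemma lag0X_fixpoint : lag0 'X = \sum_i mlsX K i * mls_eval (lag0 'X) (P i).
Proof.
apply/ffunP=> A; rewrite mls_coef_sum.
under eq_bigr => i _ do rewrite mlsX_mulE -lag0_eval.
rewrite -big_mkcond /= ffunE.
under eq_bigr => i _ do rewrite ffunE.
rewrite -horner_sum; have [->|] := eqVneq A set0.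
  by rewrite ffunE eqxx hornerX big_set0 horner0.
rewrite -card_gt0 => A0; congr (_.[_]); rewrite ffunE -cards_eq0 gtn_eqF //.
rewrite derivX mul1r; have [s As] : {s | #|A| = s.+1} by exists #|A|.-1; rewrite prednK.
have As' i : i \in A -> #|A :\ i| = s by move=> iA; move: As; rewrite (cardsD1 i A) iA => -[].
(* On a singleton the right-hand side falls under the [set0] branch of [lagL]. *)
case: s As As' => [|s] As As'.
  have /eqP/cards1P[i ->] := As.
  by rewrite !big_set1 ffunE setDv eqxx cards1.
transitivity (\sum_(i in A) ((P i)^`() * \prod_(j in A :\ i) P j)^`(s)); last first.
  by apply: eq_bigr => i iA; rewrite ffunE -cards_eq0 As'.
rewrite As [_.+2.-1]/= derivSn deriv_prod raddf_sum.
by apply: eq_bigr => i iA.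
Qed.

(** By uniqueness [R] is [lag0 'X], and the derivative of order |I| - 1 at 0 of (k + 1) x^k prod_i
    P_i is (|I| - 1)! times a coefficient. *)
Lemma lagrange R k : (0 < #|I|)%N ->
  R = \sum_i mlsX K i * mls_eval R (P i) ->
  (R ^+ k.+1) [set: I] =
  ('X^k * \prod_i P i)`_(#|I|.-1) *+ (k.+1 * (#|I|.-1)`!).
Proof.
move=> I0 RE; rewrite (mls_fixpoint_unique RE lag0X_fixpoint) -rmorphXn /=.
rewrite !ffunE -cards_eq0 cardsT gtn_eqF // derivXn /= mulrnAl derivnMn hornerMn.
rewrite horner_coef0 coef_derivn addn0 ffactnn mulnC mulrnA.
by under [in LHS]eq_bigl => i do rewrite inE.
Qed.
End Lagrange.

(** * Narayana polynomials *)

Section Narayana.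
Variables (I : finType) (K : comNzRingType).

(** A sum of square-zero variables acts as one variable x, nilpotent of order |I| + 1 over the
    rationals, with x^n equal to n! times an elementary symmetric polynomial. *)
Lemma mlsX_sum_exp n (A : {set I}) :
  ((\sum_i mlsX K i) ^+ n) A = (n`! * (#|A| == n))%:R.
Proof.
elim: n A => [|n IHn] A; first by rewrite mls1 cards_eq0 mul1n.
rewrite exprS mulr_suml mls_coef_sum.
under eq_bigr => i _ do rewrite mlsX_mulE IHn.
rewrite -big_mkcond /=.
transitivity (\sum_(i in A) (n`! * (#|A| == n.+1))%:R : K).
  by apply: eq_bigr => i iA; rewrite (cardsD1 i A) iA.
rewrite sumr_const -mulrnA; congr (_%:R).
by case: eqP => [->|]; rewrite ?muln0 ?mul0n // !muln1 mulnC factS.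
Qed.

Lemma mls_evalE (R : mls I K) (p : {poly K}) n : (size p <= n)%N ->
  mls_eval R p = \sum_(i < n) mls_const I p`_i * R ^+ i.
Proof.
move=> pn; have {1}-> : p = \sum_(i < n) (p`_i)%:P * 'X^i.
  rewrite -[LHS]coefK poly_def (big_ord_widen _ (fun i => p`_i *: 'X^i) pn).
  rewrite big_mkcond /=; apply: eq_bigr => i _; rewrite mul_polyC; case: ltnP => // ip.
  by rewrite nth_default // scale0r.
rewrite rmorph_sum; apply: eq_bigr => i _.
by rewrite rmorphM rmorphXn /= mls_evalC mls_evalX.
Qed.

Lemma mls_eval_sumX (p : {poly K}) (A : {set I}) :
  mls_eval (\sum_i mlsX K i) p A = p`_#|A| *+ #|A|`!.
Proof.
rewrite (mls_evalE _ (leq_maxl (size p) #|A|.+1)) mls_coef_sum.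
under eq_bigr => i _ do rewrite mls_const_mulE mlsX_sum_exp.
have Al : (#|A| < maxn (size p) #|A|.+1)%N by rewrite leq_max ltnSn orbT.
rewrite (bigD1 (Ordinal Al)) //= eqxx muln1 mulr_natr big1 ?addr0 // => i.
by rewrite -val_eqE /= eq_sym => /negbTE ->; rewrite muln0 mulr0.
Qed.
End Narayana.

Lemma coef_affine_exp (K : comNzRingType) (c d : K) n i : (i <= n)%N ->
  ((c%:P + d%:P * 'X) ^+ n)`_i = c ^+ (n - i) * d ^+ i *+ 'C(n, i).
Proof.
move=> ni; rewrite exprDn coef_sum.
have il : (i < n.+1)%N by [].
rewrite (bigD1 (Ordinal il)) //= big1 ?addr0 => [|j].
  by rewrite coefMn exprMn -!polyC_exp coefCM coefCM coefXn eqxx mulr1.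
rewrite -val_eqE /= eq_sym => /negbTE ji.
by rewrite coefMn exprMn -!polyC_exp !coefCM coefXn ji !mulr0 mul0rn.
Qed.

(* For [n > 0], [U n] is the coefficient of [x ^ n] in the solution of [y = x (U 0 + y) (1 - y)]; Lagrange
   inversion is applied to it with [x] a sum of [b] square-zero variables. *)
Lemma narayana (K : comNzRingType) (b : nat) (U : nat -> K) : (0 < b)%N ->
  (forall n, (n < b)%N -> U n.+1 = U n - \sum_(a < n) U a.+1 * U (n - a.+1)%N) ->
  U b *+ b`! =
  (\sum_(i < b) (U 0%N ^+ i.+1 * (- 1) ^+ i) *+ ('C(b, i.+1) * 'C(b, i))) *+ (b.-1)`!.
Proof.
(* The solution is truncated at degree [b]; its constant term is 0 because [U 0] enters [P]
   separately. *)
move=> b0 UE; pose Y := \poly_(n < b.+1) (if n is 0 then 0 else U n).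
pose P := ((U 0%N)%:P + 'X) * (1 - 'X).
pose t := \sum_(i < b) mlsX K i.
have YE : mls_eval t Y = \sum_(i < b) mlsX K i * mls_eval (mls_eval t Y) P.
  (* Powers of [t] beyond the [b]-th vanish, so coefficients are compared up to degree [b] only,
     where they obey [UE]. *)
  transitivity (mls_eval t ('X * (((U 0%N)%:P + Y) * (1 - Y)))).
    apply/ffunP=> A; rewrite !mls_eval_sumX; congr (_ *+ _).
    have : (#|A| <= b)%N by rewrite -[leqRHS]card_ord max_card.
    case: #|A| => [|n] nb; first by rewrite coefXM coef_poly.
    rewrite coefXM /= mulrBr mulr1 coefB coefD coefC !coef_poly ltnS nb (ltnW nb : (n < b.+1)%N).
    rewrite UE // mulrC coefM big_ord_recl !coef_poly mul0r add0r.
    congr (_ - _); first by case: n {nb} => [|n]; rewrite ?addr0 ?add0r.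
    apply: eq_bigr => a _; rewrite lift0 !coef_poly !ltnS.
    rewrite coefD coefC coef_poly.
    rewrite (leq_trans (ltn_ord a) (ltnW nb)) ltnS.
    rewrite (leq_trans (leq_subr _ _) (ltnW nb)).
    by case: (n - a.+1)%N => [|?]; rewrite ?addr0 ?add0r.
  rewrite 2!rmorphM /= mls_evalX -mulr_suml; congr (_ * _).
  by rewrite /P rmorphM !rmorphD !rmorphN !rmorph1 /= !mls_evalC !mls_evalX.
have := lagrange 0 (_ : 0 < #|'I_b|)%N YE; rewrite card_ord => /(_ b0).
rewrite expr1 mls_eval_sumX cardsT card_ord expr0 mul1r mul1n.
rewrite coef_poly ltnSn prodr_const card_ord.
case: b b0 {UE Y t YE} => // b _ -> /=; congr (_ *+ _).
(* Reversing the sum makes the exponent of [U 0] equal to [i.+1]. *)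
rewrite exprMn coefM; rewrite (reindex_inj rev_ord_inj) /=; apply: eq_bigr => i _.
have ib : (i <= b)%N by rewrite -ltnS.
have -> : (U 0%N)%:P + 'X = (U 0%N)%:P + 1%:P * 'X :> {poly K} by rewrite mul1r.
have -> : 1 - 'X = 1%:P + (-1)%:P * 'X :> {poly K} by rewrite polyCN mulN1r.
rewrite subSS subKn // !coef_affine_exp; [|exact: leqW|exact/leqW/leq_subr].
rewrite !expr1n mulr1 mul1r subSn ?leq_subr // subKn //.
by rewrite mulrnAl mulrnAr -mulrnA -(@bin_sub b.+1 i.+1 ib) subSS mulnC.
Qed.

(** The term of index [i] is the one of index j = i + 1 in [alpha_den], since -X^2 (-X)^(j-2) =
    (-1)^(j-1) X^j; the term i = 0 gives the leading 1. *)
Lemma mulX_alpha_den b : (0 < b)%N ->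
  'X * alpha_den b *+ b =
  \sum_(i < b) ('X ^+ i.+1 * (- 1) ^+ i) *+ ('C(b, i.+1) * 'C(b, i)) :> {poly rat}.
Proof.
case: b => // b _; rewrite /alpha_den big_ord_recl /= bin1 bin0 muln1 expr0 mulr1 expr1.
rewrite mulrBr mulr1 mulrnBl; congr (_ + _).
rewrite !big_add1 /= big_mkord mulr_sumr mulr_sumr -sumrMnl -sumrN; apply: eq_bigr => i _.
rewrite /bump /= add1n !subSS subn0 (exprNn 'X) -!scalerAr scalerMnl.
have -> (x y : rat) : (b.+1%:R^-1 * x * y) *+ b.+1 = x * y.
  by rewrite -[LHS]mulr_natr; field; rewrite addrC natr1 pnatr_eq0.
rewrite -natrM scaler_nat -mulNrn; congr (_ *+ _).
by rewrite !exprS; ring.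
Qed.

(** * Coefficients of the inverse series *)

Section Nilpotent.
Variables (I : finType) (K : comNzRingType).

Lemma mls_exp_low (R : mls I K) (j : nat) (A : {set I}) :
  R set0 = 0 -> (#|A| < j)%N -> (R ^+ j) A = 0.
Proof.
move=> R0; elim: j A => // j IHj A Aj; rewrite exprS mlsM big1 // => B BA.
have [->|B0] := eqVneq B set0; first by rewrite R0 mul0r.
rewrite IHj ?mulr0 // -ltnS (leq_trans _ Aj) // ltnS cardsD (setIidPr BA).
rewrite -subSn ?subset_leq_card // leq_subLR -[X in (X <= _)%N]add1n leq_add2r.
by rewrite card_gt0.
Qed.

(** The powers of [R] beyond the number of variables vanish, so a power series can be substituted
    through its truncation. *)
Lemma mls_eval_low (R : mls I K) (p r : {poly K}) : R set0 = 0 ->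
  (forall i, (i <= #|I|)%N -> p`_i = r`_i) -> mls_eval R p = mls_eval R r.
Proof.
move=> R0 pr; apply/ffunP=> A.
have E (s : {poly K}) : mls_eval R s A = \sum_(i < #|I|.+1) s`_i * (R ^+ i) A.
  rewrite (mls_evalE _ (leq_maxl (size s) #|I|.+1)) mls_coef_sum.
  rewrite [RHS](big_ord_widen _ (fun i => s`_i * (R ^+ i) A) (leq_maxr (size s) #|I|.+1)).
  rewrite [RHS]big_mkcond /=; apply: eq_bigr => i _; rewrite mls_const_mulE.
  case: ifP => // /negbT; rewrite -leqNgt => iI; rewrite mls_exp_low ?mulr0 //.
  by apply: leq_ltn_trans (max_card _) iI.
by rewrite !E; apply: eq_bigr => i _; rewrite pr // -ltnS.
Qed.
End Nilpotent.

Lemma inv_coef_unique (p r : {poly rat}) n : p`_0 != 0 ->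
  (forall j, (j <= n)%N -> (p * r)`_j = (j == 0%N)%:R) ->
  forall j, (j <= n)%N -> r`_j = inv_coef p j.
Proof.
move=> p0 pr; elim/ltn_ind => j IHj jn.
have := inv_coefP j p0; rewrite -(pr j jn) coefMr !big_ord_recr /= subnn.
rewrite [X in _ = X + _](eq_bigr (fun i : 'I_j => p`_(j - i) * inv_coef p i)).
  by move=> /addrI /(mulfI p0).
by move=> i _; rewrite IHj // (leq_trans _ jn) // ltnW.
Qed.

Definition trunc_inv (n : nat) (p : {poly rat}) : {poly rat} := \poly_(j < n.+1) inv_coef p j.

Lemma trunc_invP n (p : {poly rat}) j : p`_0 != 0 -> (j <= n)%N -> (p * trunc_inv n p)`_j = (j == 0%N)%:R.
Proof.
move=> p0 jn; rewrite -(inv_coefP j p0) coefMr; apply: eq_bigr => i _.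
by rewrite coef_poly (leq_trans (ltn_ord i)).
Qed.

Lemma coef_mul_low (p r s t : {poly rat}) n :
  (forall i, (i <= n)%N -> p`_i = r`_i) -> (forall i, (i <= n)%N -> s`_i = t`_i) ->
  forall i, (i <= n)%N -> (p * s)`_i = (r * t)`_i.
Proof.
move=> pr st i ni; rewrite !coefM; apply: eq_bigr => j _; rewrite pr ?st //.
  by rewrite (leq_trans (leq_subr _ _)).
by rewrite (leq_trans _ ni) // -ltnS.
Qed.

(** The product of p^e and the e-th power of the truncation is 1 modulo X^(n+1), and an inverse is
    unique to this order. *)
Lemma trunc_inv_exp n (p : {poly rat}) e j : p`_0 = 1 -> (j <= n)%N ->
  (trunc_inv n p ^+ e)`_j = inv_coef (p ^+ e) j.
Proof.
move=> p0; have pe : (p ^+ e)`_0 = 1 by rewrite -horner_coef0 horner_exp horner_coef0 p0 expr1n.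
apply: inv_coef_unique; first by rewrite pe oner_neq0.
move=> {}j jn; rewrite -exprMn -(coef1 _ j); move: j jn.
elim: e {pe} => [|e IHe] j jn; first by rewrite expr0.
have -> : (1 : {poly rat})`_j = (1 * 1 : {poly rat})`_j by rewrite mulr1.
rewrite exprS; apply: (coef_mul_low (n := n)) => // i ni.
by rewrite trunc_invP ?p0 ?oner_neq0 // coef1.
Qed.


(** * The numbers q, and auxiliary identities *)

Lemma q_prod (b j : nat) (x : rat) :
  q b j x = (j`!%:R ^+ 2)^-1 * \prod_(i < j) (x ^+ 2 - (b%:R - i%:R) ^+ 2).
Proof.
rewrite /q /binom mulrACA -invfM -expr2 mulrC; congr (_ * _).
(* After reversal the factors x + b - i and x - b + i are paired. *)
rewrite [X in _ * X](reindex_inj rev_ord_inj) -big_split /=; apply: eq_bigr => i _.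
rewrite natrB //; rewrite -addn1 natrD; ring.
Qed.

Lemma binom_nat (N k : nat) : binom N%:R k = 'C(N, k)%:R.
Proof.
rewrite /binom; apply: (canLR (mulfK _)); first by rewrite pnatr_eq0 -lt0n fact_gt0.
rewrite -natrM bin_ffact; case: (leqP k N) => kN.
  rewrite ffact_prod natr_prod; apply: eq_bigr => i _.
  by rewrite natrB // ltnW // (leq_trans (ltn_ord i)).
by rewrite ffact_small // (bigD1 (Ordinal kN)) //= subrr mul0r.
Qed.

Lemma q_nat (b k m : nat) : (b < m)%N ->
  q b k m%:R = ('C(m + b, k) * 'C(m - b.+1 + k, k))%:R.
Proof.
move=> bm; rewrite natrM -!binom_nat !natrD natrB // -natr1 /q; congr (_ * binom _ _).
by ring.
Qed.

(** A special dual vertex bears only leaflets; the general formula agrees with this at m = b. *)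
Lemma q_diag (b k : nat) : q b k b%:R = (k == 0%N)%:R.
Proof.
case: k => [|k]; first by rewrite /q /binom !big_ord0 fact0 divr1 mulr1.
rewrite /q; have -> : b%:R - b%:R - 1 + k.+1%:R = k%:R :> rat by rewrite -natr1; ring.
by rewrite [binom k%:R _]binom_nat bin_small ?mulr0.
Qed.

(** For b <= m, all q_j(m) with j > m + b vanish, so a large [N] loses nothing. *)
Definition qpoly (b N m : nat) : {poly rat} := \poly_(j < N) q b j m%:R.

Lemma mls_mulrnI (I : finType) k (f g : mls I rat) : f *+ k = g *+ k -> (0 < k)%N -> f = g.
Proof.
move=> fg k0; apply/ffunP=> B; have /ffunP/(_ B) := fg.
by rewrite !mlsMn => /(pmulrnI k0).
Qed.

Lemma coef_exp_low (K : comNzRingType) (H : {poly K}) j i : H`_0 = 0 -> (i < j)%N ->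
  (H ^+ j)`_i = 0.
Proof.
move=> H0; elim: j i => // j IHj i ij; rewrite exprS coefM big1 // => -[[|a] ai] _ /=.
  by rewrite H0 mul0r.
by rewrite IHj ?mulr0 //; lia.
Qed.

(** The geometric sum satisfies W = 1 + H W - H^(N+1), and the last term has no coefficient of
    degree at most [N]. *)
Lemma geometric_coefS (K : comNzRingType) (H : {poly K}) N i : H`_0 = 0 -> (i < N)%N ->
  (\sum_(j < N.+1) H ^+ j)`_i.+1 =
  \sum_(a < i.+1) H`_a.+1 * (\sum_(j < N.+1) H ^+ j)`_(i - a).
Proof.
move=> H0 iN; set W := \sum_(j < _) _.
have WE : W = 1 + H * W - H ^+ N.+1.
  rewrite {2}/W [in RHS]big_ord_recr mulrDr -exprS addrA addrK mulr_sumr.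
  by rewrite {1}/W big_ord_recl; congr (_ + _); apply: eq_bigr => j _; rewrite lift0 exprS.
rewrite {1}WE coefB coefD coef1 add0r coef_exp_low // subr0 coefM big_ord_recl H0 mul0r add0r.
by apply: eq_bigr => a _; rewrite lift0.
Qed.

(** A repeated variable kills the product: this is what enforces distinct numbers. *)
Lemma prod_mlsX (I : finType) (s : seq I) (B : {set I}) :
  (\prod_(i <- s) mlsX rat i) B = (uniq s && (B == [set i in s]))%:R.
Proof.
elim: s B => [|i s IHs] B.
  by rewrite big_nil mls1 /=; congr (nat_of_bool _)%:R; congr (_ == _); apply/setP=> x; rewrite !inE.
rewrite big_cons mlsX_mulE; have [iB|iB] := boolP (i \in B); last first.
  rewrite [in RHS](_ : _ && _ = false) //; apply/negbTE; apply: contra iB => /andP[_ /eqP->].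
  by rewrite !inE eqxx.
rewrite IHs /= -andbA; congr (nat_of_bool _)%:R; case: (uniq s); rewrite ?andbF //=.
apply/eqP/andP => [Bs|[si /eqP Bs]].
  have si : i \notin s.
    by have : (i \in B :\ i) = false; [rewrite !inE eqxx|rewrite Bs inE => ->].
  split=> //; apply/eqP/setP=> x; have /setP/(_ x) := Bs; rewrite !inE.
  by case: eqP => [->|].
apply/setP=> x; rewrite Bs !inE; case: eqP => // ->; exact/esym/negbTE.
Qed.

HB.instance Definition _ (L : Type) := boolp.gen_eqMixin (tree L).

Lemma all_flatten (T : Type) (p : pred T) (ss : seq (seq T)) :
  all p (flatten ss) = all (all p) ss.
Proof. by elim: ss => //= s ss IHss; rewrite all_cat IHss. Qed.

(** * Tight sequences of decorations *)

Section Words.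
Variable T : eqType.

Fixpoint words (N : nat) (s : seq T) : seq (seq T) :=
  if N is N'.+1 then [seq x :: w | x <- s, w <- words N' s] else [:: [::]].

Lemma mem_words N s w : (w \in words N s) = (size w == N) && all (mem s) w.
Proof.
elim: N w => [|N IHN] [|x w] //=.
  by apply/negbTE/allpairsP => -[[x w] /= [_ _]].
rewrite eqSS andbCA -IHN; apply/allpairsP/andP => [[[y v] /= [ys vN [-> ->]]]|[xs wN]] //.
by exists (x, w).
Qed.

Lemma words_uniq N s : uniq s -> uniq (words N s).
Proof.
move=> us; elim: N => //= N IHN; apply: allpairs_uniq => //.
by move=> [x v] [y w] _ _ /= [-> ->].
Qed.

Lemma sum_words (K : comNzRingType) (f : T -> K) N s :
  \sum_(w <- words N s) \prod_(x <- w) f x = (\sum_(x <- s) f x) ^+ N.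
Proof.
elim: N => [|N IHN] /=; first by rewrite big_seq1 big_nil.
rewrite big_allpairs_dep exprS mulr_suml; apply: eq_bigr => x _.
by rewrite -IHN mulr_sumr; apply: eq_bigr => w _; rewrite big_cons.
Qed.
End Words.

Lemma size_flatten_geq (S : eqType) (U : Type) (f : S -> seq U) (s : seq S) x c :
  (forall y, y \in s -> c <= size (f y))%N -> x \in s ->
  (size (f x) + c * (size s).-1 <= size (flatten [seq f y | y <- s]))%N.
Proof.
move=> fs xs; have ps := perm_to_rem xs.
rewrite size_flatten /shape -map_comp sumnE big_map (perm_big _ ps) big_cons leq_add2l.
have le : (\sum_(y <- rem x s) c <= \sum_(y <- rem x s) size (f y))%N.
  rewrite big_seq [X in (_ <= X)%N]big_seq; apply: leq_sum => y /mem_rem ys; exact: fs.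
by apply: leq_trans le; rewrite big_const_seq count_predT size_rem // iter_addn_0 mulnC.
Qed.

Section TightWords.
Variables (K : comNzRingType) (S : eqType) (s : seq S) (f : S -> K).
Variables (leaf twig att : pred S) (R : K).
Hypothesis twigNleaf : forall x, twig x -> ~~ leaf x.
Hypothesis attNleaf : forall x, att x -> ~~ leaf x.
Hypothesis attNtwig : forall x, att x -> ~~ twig x.
Hypothesis sum_leaf : \sum_(x <- s | leaf x) f x = 1.
Hypothesis sum_twig : \sum_(x <- s | twig x) f x = 1.
Hypothesis sum_att : \sum_(x <- s | att x) f x = R.

Let letter x := [|| leaf x, twig x | att x].
Let follows x y := ~~ (twig x && leaf y).

(* [e] tells whether the letter preceding the word is a twig *)
Let tight_after (e : bool) (w : seq S) :=
  if w is x :: w' then ~~ (e && leaf x) && path follows x w' else true.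

Let V (e : bool) (N t : nat) : K :=
  \sum_(w <- words N s | [&& all letter w, tight_after e w & count twig w == t])
     \prod_(x <- w) f x.

Let tight_afterE x w : path follows x w = tight_after (twig x) w.
Proof. by case: w. Qed.

Let V_small e N t : (N < t)%N -> V e N t = 0.
Proof.
move=> Nt; rewrite /V big1_seq // => w /andP[/and3P[_ _ /eqP ct]].
rewrite mem_words => /andP[/eqP sz _].
by have := count_size twig w; rewrite ct sz leqNgt Nt.
Qed.

(** Case on the first letter: a leaf, barred after a twig; a twig, which uses up one of the [t]; or
    an attaching point. *)
Let VS e N t : V e N.+1 t =
  (if e then 0 else V false N t) + (if t is t'.+1 then V true N t' else 0) + R * V false N t.
Proof.
rewrite /V big_mkcond big_allpairs_dep /=.
transitivity (\sum_(x <- s) ((if leaf x then f x else 0) * (if e then 0 else V false N t)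
  + (if twig x then f x else 0) * (if t is t'.+1 then V true N t' else 0)
  + (if att x then f x else 0) * V false N t)); last first.
  by rewrite !big_split /= -!mulr_suml -!big_mkcond sum_leaf sum_twig sum_att !mul1r.
apply: eq_bigr => x _.
have VE e' t' : f x * V e' N t' = \sum_(w <- words N s)
    (if [&& all letter w, tight_after e' w & count twig w == t'] then \prod_(y <- x :: w) f y else 0).
  rewrite /V mulr_sumr big_mkcond; apply: eq_bigr => w _.
  by rewrite big_cons; case: ifP.
under eq_bigr => w _ do rewrite tight_afterE /letter -!andbA.
have [lx|nlx] := boolP (leaf x).
  have -> : twig x = false by apply: contraTF lx => /twigNleaf.
  have -> : att x = false by apply: contraTF lx => /attNleaf.
  rewrite !mul0r !addr0 andbT; case: e => /=.
    by rewrite mulr0 big1 // => w _; rewrite andbF.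
  by rewrite VE; apply: eq_bigr => w _.
have [tx|ntx] := boolP (twig x).
  have -> : att x = false by apply: contraTF tx => /attNtwig.
  rewrite !mul0r add0r addr0 andbF /=; case: t => [|t].
    by rewrite mulr0 big1 // => w _; rewrite !andbF.
  by rewrite VE; apply: eq_bigr => w _.
rewrite !mul0r !add0r andbF /=; have [ax|nax] := boolP (att x).
  by rewrite VE; apply: eq_bigr => w _.
by rewrite mul0r big1.
Qed.

(** Among the [a] letters other than twigs, [k] are attaching points; the [t] twigs are spread over
    k + 1 places, before one of these or at the end, in C(t + k, k) ways. *)
Definition tight_gf (R : K) (a t : nat) : K :=
  \sum_(k < a.+1) R ^+ k *+ ('C(a, k) * 'C(t + k, k)).

Let G := tight_gf R.

Let G_widen a t M : (a < M)%N -> G a t = \sum_(k < M) R ^+ k *+ ('C(a, k) * 'C(t + k, k)).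
Proof.
move=> aM; rewrite /G /tight_gf (big_ord_widen _ (fun k => R ^+ k *+ ('C(a, k) * 'C(t + k, k))) aM).
rewrite big_mkcond; apply: eq_bigr => k _; case: ifP => // /negbT.
by rewrite -leqNgt => ak; rewrite bin_small.
Qed.

Let GS0 a : G a.+1 0 = (1 + R) * G a 0.
Proof.
have E c : G c 0 = (1 + R) ^+ c.
  rewrite exprDn; apply: eq_bigr => k _.
  by rewrite expr1n mul1r add0n binn muln1.
by rewrite !E exprS.
Qed.

(** Pascal's rule on both binomials. This is the recurrence [VS] for [e = false], once its value for
    [e = true] is eliminated. *)
Let GSS a t : G a.+1 t.+1 = (1 + R) * G a t.+1 + G a.+1 t - G a t.
Proof.
apply: (canRL (addrK _)); rewrite mulrDl mul1r.
have -> : R * G a t.+1 = \sum_(k < a.+1) R ^+ k.+1 *+ ('C(a, k) * 'C(t.+1 + k, k)).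
  by rewrite mulr_sumr; apply: eq_bigr => k _; rewrite mulrnAr exprS.
rewrite (@G_widen a t a.+2) ?leqnSn // (@G_widen a t.+1 a.+2) ?leqnSn // /G /tight_gf.
rewrite !(big_ord_recl a.+1) !bin0 !muln1 !expr0 !mulr1n.
have E (x y z u v : K) : x + y = z + u + v -> 1 + x + (1 + y) = 1 + z + u + (1 + v).
  by move=> e; rewrite addrACA e; ring.
apply: E; rewrite -!big_split /=; apply: eq_bigr => k _.
rewrite -!mulrnDr; congr (_ *+ _); rewrite /bump !add1n.
by rewrite addSn !binS addSnnS; ring.
Qed.

Lemma tight_words a t :
  \sum_(w <- words (a + t) s | [&& all letter w, sorted follows w & count twig w == t])
     \prod_(x <- w) f x = tight_gf R a t.
Proof.
have -> : tight_gf R a t = V false (a + t) t; last by apply: eq_bigl => -[].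
(* The subtracted term counts the words starting with a leaf, which are excluded after a twig. *)
suff H N : forall a t, N = (a + t)%N ->
    V false N t = G a t /\ V true N t = G a t - (if a is a'.+1 then G a' t else 0).
  by have [->] := H _ a t erefl.
have G0 c : G 0 c = 1 by rewrite /G /tight_gf big_ord_recl big_ord0 addr0 !bin0.
elim: N => [|N IHN] {}a {}t.
  case: a t => [|a] [|t] // _; rewrite G0 subr0.
  by split; rewrite /V big_mkcond big_seq1 /= big_nil.
rewrite !VS; case: a t => [|a] [|t] //.
- rewrite add0n => -[Nt]; subst N; rewrite V_small //.
  have [_ ->] := IHN 0%N t erefl; by rewrite !G0 !subr0 mulr0 addr0 add0r.
- rewrite addn0 => -[Na]; have [-> _] := IHN a 0%N (etrans Na (esym (addn0 a))).
  by rewrite GS0; split; ring.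
rewrite addSn addnS => -[Na].
have [-> _] := IHN a t.+1 (etrans Na (esym (addnS a t))).
have [_ ->] := IHN a.+1 t (etrans Na (esym (addSn a t))).
by rewrite GSS; split; ring.
Qed.
End TightWords.

Arguments edge_ok : simpl never.

(** * Generating functions of decorated trees *)

Section Trees.
Variables (n b : nat) (m : 'I_n -> nat).
Local Notation T := (tree 'I_n).
Local Notation A := (mls 'I_n rat).

Fixpoint height (t : T) : nat :=
  match t with
  | Primal _ cs => (foldr maxn 0%N [seq height c.2 | c <- cs]).+1
  | Dual _ ds => (foldr maxn 0%N [seq (if d is Some t' then height t' else 0%N) | d <- ds]).+1
  end.

Lemma foldr_maxn_leq s h : (foldr maxn 0 s <= h)%N = all (leq^~ h) s.
Proof. by elim: s => //= x s IHs; rewrite geq_max IHs. Qed.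

Lemma height_Primal_leq a cs h :
  (height (Primal a cs) <= h.+1)%N = all (fun c => height c.2 <= h)%N cs.
Proof. by rewrite /= ltnS foldr_maxn_leq all_map. Qed.

Lemma height_Dual_leq l ds h :
  (height (Dual l ds) <= h.+1)%N =
  all (fun d => if d is Some t then height t <= h else true)%N ds.
Proof. by rewrite /= ltnS foldr_maxn_leq all_map; apply: eq_all => -[]. Qed.

(** Subtrees sit inside lists, so the induction goes through the height. *)
Lemma tree_height_ind (P : T -> Prop) :
  (forall a cs, (forall c, c \in cs -> P c.2) -> P (Primal a cs)) ->
  (forall l ds, (forall t, Some t \in ds -> P t) -> P (Dual l ds)) ->
  forall t, P t.
Proof.
move=> HP HD t; have [h] := ubnP (height t); move/ltnW.
elim: h t => [|h IHh] [a cs|l ds] //.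
  by rewrite height_Primal_leq => /allP H; apply: HP => c cI; apply/IHh/H.
by rewrite height_Dual_leq => /allP H; apply: HD => t tI; apply/IHh/(H (Some t)).
Qed.

(** Distinctness of the numbers is not a local condition and is left to the weights; validity can
    then be checked vertex by vertex. *)
Definition valid (t : T) : bool :=
  [&& decorated b t, tight t & all (fun x => x.2 == 2 * m x.1)%N (blossoms t)].

Lemma valid_Primal a cs : valid (Primal a cs) =
  primal_ok b (a :: [seq c.1 | c <- cs]) &&
  all (fun c => edge_ok b (PrimalHalf c.1) (top_half c.2) && valid c.2) cs.
Proof.
rewrite /valid /= all_flatten all_map -!andbA; congr (_ && _).
rewrite -!all_predI; apply: eq_all => c /=.
by rewrite -!andbA.
Qed.

Lemma valid_Dual l ds : valid (Dual l ds) =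
  [&& (size ds).+1 == (2 * m l)%N, dual_ok b ds,
      sorted (fun x y => ~~ (is_twig x && is_leaflet y)) ds
    & all (fun d => if d is Some t
                    then edge_ok b (DualHalf (size ds).+1) (top_half t) && valid t
                    else true) ds].
Proof.
rewrite /valid /= all_flatten all_map.
set X := _ == (2 * m l)%N; set Y := dual_ok _ _; set Z := sorted _ _.
transitivity [&& X, Y, Z & [&& all (fun d => if d is Some t'
         then edge_ok b (DualHalf (size ds).+1) (top_half t') && decorated b t' else true) ds,
     all (fun d => if d is Some t' then tight t' else true) ds &
     all (preim (fun d => if d is Some t' then blossoms t' else [::])
           (all (fun x => x.2 == (2 * m x.1)%N))) ds]].
  by move: X Y Z => [] [] [] /=; rewrite ?andbF ?andbT -?andbA.
congr [&& _, _, _ & _]; rewrite -!all_predI; apply: eq_all => -[t|] //=.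
by rewrite -!andbA.
Qed.

(** [primal_ok] bounds the arrows on a half-edge by [b] and the number of children by [b.+1]. *)
Definition primal_children (E : seq T) : seq (seq (nat * T)) :=
  flatten [seq words j [seq (a, t) | a <- iota 0 b.+1, t <- E] | j <- iota 0 b.+2].

Definition primal_trees (E : seq T) : seq T :=
  [seq Primal a cs | a <- iota 0 b.+1, cs <- primal_children E].

Definition dual_trees (E : seq T) : seq T :=
  [seq Dual l ds | l <- enum 'I_n, ds <- words (2 * m l).-1 (None :: map Some E)].

(** Numbers may repeat in a valid tree, so a bound on the height keeps the list finite. *)
Fixpoint trees (h : nat) : seq T :=
  if h is h'.+1 then [seq t <- primal_trees (trees h') ++ dual_trees (trees h') | valid t]
  else [::].

Lemma treesS h :
  trees h.+1 = [seq t <- primal_trees (trees h) ++ dual_trees (trees h) | valid t].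
Proof. by []. Qed.

Lemma primal_ok_bounds a cs : primal_ok b (a :: cs) ->
  [/\ (a <= b)%N, all (leq^~ b) cs & (size cs <= b.+1)%N].
Proof.
rewrite /primal_ok /=; case: ifP => [_ /eqP[-> ->] //|_ /andP[/andP[/andP[_ ab] csb] /eqP sum]].
split=> //; first by apply: sub_all csb => x /andP[].
rewrite -sum; apply: leq_trans (leq_addl _ _).
elim: cs csb {sum} => //= x cs IHcs /andP[/andP[x0 _] csb].
by rewrite -add1n leq_add // IHcs.
Qed.

Lemma mem_trees h t : (t \in trees h) = valid t && (height t <= h)%N.
Proof.
elim: h t => [|h IHh] t; first by case: t => ? ?; rewrite andbF.
rewrite treesS mem_filter; case tv: (valid t); rewrite ?andFb // !andTb.
case: t tv => [a cs|l ds] tv; rewrite mem_cat /primal_trees /dual_trees.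
  rewrite height_Primal_leq [X in _ || X](_ : _ = false) ?orbF; last first.
    by apply/negbTE/allpairsPdep => -[x [w [_ _]]].
  have := tv; rewrite valid_Primal => /andP[/primal_ok_bounds[ab csb css] /allP csv].
  apply/allpairsP/allP => [[[a' cs'] /= [_ cs'I [_ ->]]] c cI|H].
    have /flatten_mapP[j _] := cs'I.
    rewrite mem_words => /andP[_ /allP /(_ c cI) /allpairsP[[a0 t0] /= [_ t0I ->]]].
    by move: t0I; rewrite IHh => /andP[].
  exists (a, cs); split=> //; first by rewrite mem_iota ltnS.
  apply/flatten_mapP; exists (size cs); first by rewrite mem_iota ltnS; rewrite size_map in css.
  rewrite mem_words eqxx; apply/allP => -[a' t'] cI.
  apply/allpairsP; exists (a', t'); split=> //.
    rewrite mem_iota ltnS; move/allP: csb; apply.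
    by apply/mapP; exists (a', t').
  by rewrite IHh (H _ cI) andbT; case/andP: (csv _ cI).
rewrite height_Dual_leq [X in X || _](_ : _ = false); last first.
  by apply/negbTE/allpairsP => -[[x w] [_ _]].
have := tv; rewrite valid_Dual => /and4P[/eqP sz _ _ /allP dsv].
apply/allpairsPdep/allP => [[l' [ds' [_ ds'I [_ ->]]]] [t|//] tI|H].
  move: ds'I; rewrite mem_words => /andP[_ /allP /(_ _ tI)].
  by rewrite inE /= => /mapP[t0]; rewrite IHh => /andP[_ H] [->].
exists l, ds; split=> //; first by rewrite mem_enum.
rewrite mem_words -sz eqxx; apply/allP => -[t|//] tI.
rewrite inE /=; apply/mapP; exists t => //.
by rewrite IHh (H _ tI) andbT; case/andP: (dsv _ tI).
Qed.

Lemma trees_uniq h : uniq (trees h).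
Proof.
elim: h => // h IHh; rewrite treesS; apply: filter_uniq; rewrite cat_uniq; apply/and3P; split.
- apply: allpairs_uniq; [exact: iota_uniq| |by move=> [? ?] [? ?] _ _ /= [-> ->]].
  have uw j : uniq (words j [seq (a', t) | a' <- iota 0 b.+1, t <- trees h]).
    apply/words_uniq/allpairs_uniq => //; first exact: iota_uniq.
    by move=> [? ?] [? ?] _ _ /= [-> ->].
  rewrite /primal_children; elim: (iota 0 b.+2) (iota_uniq 0 b.+2) => //= j s IHs /andP[js us].
  rewrite cat_uniq uw IHs // andbT; apply/hasPn => w /flatten_mapP[i iI].
  rewrite !mem_words => /andP[/eqP wi _]; rewrite wi; apply/negP => /andP[/eqP ij _].
  by rewrite -ij iI in js.
- apply/hasPn => t /allpairsPdep[l [ds [_ _ ->]]].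
  by apply/allpairsP => -[[x w] /= [_ _]].
- apply: allpairs_uniq_dep => [|l _|]; first exact: enum_uniq.
    by apply: words_uniq; rewrite /= map_inj_uniq ?IHh ?andbT //; [apply/mapP => -[]|move=> ? ? []].
  by move=> [? ?] [? ?] _ _ /= [-> ->].
Qed.

(** * Weights, and compositions of arrows around primal vertices *)

Definition wt (t : T) : A := \prod_(x <- blossoms t) mlsX rat x.1.

Definition gf (h : nat) (p : pred T) : A := \sum_(t <- trees h | p t) wt t.

Definition top_primal (a : nat) (t : T) : bool := if t is Primal a' _ then a' == a else false.

(* what may hang from an edge-vertex reached through a primal half-edge with [a] arrows *)
Definition beyond (a : nat) (t : T) : bool := edge_ok b (PrimalHalf a) (top_half t).

(** Index 0 is left out: a half-edge without arrows occurs only at a primal vertex of degree one. *)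
Definition beyond_poly (h : nat) : {poly A} :=
  \poly_(a < b.+1) (if a is 0 then 0 else gf h (beyond a)).

Lemma wt_Primal a cs : wt (Primal a cs : T) = \prod_(c <- cs) wt c.2.
Proof. by rewrite /wt /= big_flatten big_map. Qed.

Lemma wt_Dual l ds : wt (Dual l ds : T) =
  mlsX rat l * \prod_(d <- ds) (if d is Some t then wt t else 1).
Proof.
rewrite /wt /= big_cons big_flatten big_map; congr (_ * _).
by apply: eq_bigr => -[t|] _ //; rewrite big_nil.
Qed.

Lemma valid_Primal_in a cs : (1 <= a <= b)%N ->
  (forall c, c \in cs -> valid c.2) ->
  valid (Primal a cs) =
  all (fun c => (1 <= c.1 <= b)%N && beyond c.1 c.2) cs
  && (sumn [seq c.1 | c <- cs] == b.+1 - a)%N.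
Proof.
move=> /andP[a1 ab] csv; rewrite valid_Primal.
have -> : all (fun c => beyond c.1 c.2 && valid c.2) cs = all (fun c => beyond c.1 c.2) cs.
  by apply: eq_in_all => c cI; rewrite csv // andbT.
rewrite all_predI [in RHS]andbAC; congr (_ && _).
rewrite /primal_ok /= a1 ab /= all_map eqSS size_eq0.
case: cs csv => [|c cs] csv //=.
  (* Without children both sides fail: the half-edge of a vertex of degree one carries no arrow, and
     b + 1 - a is positive. *)
  by rewrite eqseq_cons (gtn_eqF a1) /= eq_sym subn_eq0 ltnNge ab.
by congr (_ && _); rewrite -[RHS](eqn_add2l a) subnKC // ltnW.
Qed.

(** Exponents record arrows: sequences of [j] children contribute the [j]-th power of [beyond_poly],
    and the total b + 1 leaves b + 1 - a arrows for the children. *)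
Lemma gf_primal h a : (1 <= a <= b)%N ->
  gf h.+1 (top_primal a) = (\sum_(j < b.+2) beyond_poly h ^+ j)`_(b.+1 - a).
Proof.
move=> ab1; have /andP[a1 ab] := ab1.
pose f (c : nat * T) : {poly A} :=
  if (1 <= c.1 <= b)%N && beyond c.1 c.2 then (wt c.2)%:P * 'X^(c.1) else 0.
have f_prod cs : \prod_(c <- cs) f c =
    if all (fun c => (1 <= c.1 <= b)%N && beyond c.1 c.2) cs
    then (\prod_(c <- cs) wt c.2)%:P * 'X^(sumn [seq c.1 | c <- cs]) else 0.
  elim: cs => [|c cs IHcs]; first by rewrite !big_nil mul1r.
  rewrite !big_cons IHcs /= {1}/f; case: ifP => _; rewrite ?mul0r //.
  case: ifP => _; rewrite ?mulr0 // exprD polyCM; ring.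
have f_sum : \sum_(c <- [seq (a', t) | a' <- iota 0 b.+1, t <- trees h]) f c = beyond_poly h.
  rewrite big_allpairs_dep -[iota _ _]/(index_iota 0 b.+1) big_mkord /beyond_poly poly_def.
  apply: eq_bigr => -[[|i] /= ib] _; first by rewrite scale0r big1.
  rewrite -mul_polyC /gf rmorph_sum mulr_suml [RHS]big_mkcond.
  by apply: eq_bigr => t _; rewrite /f /= -ltnS ib; case: ifP; rewrite ?mul0r.
transitivity (\sum_(cs <- primal_children (trees h) | valid (Primal a cs)) wt (Primal a cs : T)).
  rewrite /gf treesS big_filter_cond big_cat /= [X in _ + X]big_mkcond.
  rewrite big_allpairs_dep [X in _ + X]big1 ?addr0; last first.
    by move=> l _; apply: big1 => ds _; rewrite /= andbF.
  rewrite big_mkcond big_allpairs_dep (bigD1_seq a) ?iota_uniq ?mem_iota ?ltnS //=.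
  rewrite [X in _ + X]big1 ?addr0.
    by rewrite [RHS]big_mkcond; apply: eq_bigr => cs _; rewrite eqxx andbT.
  by move=> a' /negbTE a'a; apply: big1 => cs _; rewrite a'a andbF.
transitivity (\sum_(cs <- primal_children (trees h)) (\prod_(c <- cs) f c)`_(b.+1 - a)).
  rewrite big_mkcond; apply: eq_big_seq => cs csI.
  rewrite valid_Primal_in // => [|c cI]; last first.
    have /flatten_mapP[j _] := csI; rewrite mem_words => /andP[_ /allP /(_ c cI)].
    by move=> /allpairsP[[a0 t0] [_ t0I ->]]; move: t0I; rewrite mem_trees => /andP[].
  rewrite f_prod wt_Primal; case: all => /=; last by rewrite coef0.
  by rewrite coefCM coefXn eq_sym; case: eqP; rewrite ?mulr1 ?mulr0.
rewrite -coef_sum; congr (polyseq _)`__.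
rewrite /primal_children big_flatten big_map -[iota 0 b.+2]/(index_iota 0 b.+2) big_mkord.
by apply: eq_bigr => j _; rewrite sum_words f_sum.
Qed.

Lemma wtE (t : T) (B : {set 'I_n}) :
  wt t B = (uniq [seq x.1 | x <- blossoms t] && (B == [set i in [seq x.1 | x <- blossoms t]]))%:R.
Proof. by rewrite -prod_mlsX /wt big_map. Qed.

(** Down a chain of primal vertices of degree two, the arrow count on the half-edge towards the root
    drops by one at each step. Each blossoming vertex pays b + 1: at a dual vertex this is its own
    share, at a branching that of another subtree. The maximum with 1 covers the twig, of height
    1. *)
Lemma height_leq (t : T) : (0 < b)%N -> valid t ->
  (height t <= b.+1 * size (blossoms t) + (if t is Primal a _ then maxn a 1 else 0))%N /\
  (~~ is_twig (Some t) -> (0 < size (blossoms t))%N).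
Proof.
move=> b0; elim/tree_height_ind: t => [a cs IH|l ds IH] tv; last first.
  split=> //; rewrite addn0 [size _]/= mulnS [X in (_ <= X)%N]addSn height_Dual_leq.
  apply/allP => -[t|//] tI.
  have /andP[_ tv'] : edge_ok b (DualHalf (size ds).+1) (top_half t) && valid t.
    by move: tv; rewrite valid_Dual => /and4P[_ _ _ /allP /(_ _ tI)].
  have [le _] := IH t tI tv'; apply: leq_trans le _; rewrite [X in (_ <= X)%N]addnC leq_add //.
    rewrite leq_mul2l orFb.
    have := @size_flatten_geq _ _ (fun d => if d is Some t' then blossoms t' else [::]) ds _ 0
      (fun _ _ => leq0n _) tI.
    by rewrite mul0n addn0.
  case: t {IH tI} tv' => // a cs.
  rewrite valid_Primal => /andP[/primal_ok_bounds[ab _ _] _].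
  by rewrite geq_max ab.
move: (tv); rewrite valid_Primal => /andP[]; rewrite /primal_ok.
case: cs IH tv => [|c0 cs0] IH tv; first by move=> /eqP[->]; rewrite muln0.
set cs := c0 :: cs0 in IH tv *.
have -> : (size (a :: [seq c.1 | c <- cs]) == 1)%N = false by [].
move=> /andP[/andP[/andP[a1 ab] csb] /eqP sum_cs] /allP csv.
have nt c : c \in cs -> (0 < size (blossoms c.2))%N.
  move=> cI; have /andP[e cv] := csv c cI; apply: (IH c cI cv).2.
  by case: c cI e cv => a' [[|a2] cs2|//] //= cI; rewrite /edge_ok /= andbF.
split; last by move=> _; rewrite size_cat (leq_trans (nt c0 _)) ?inE ?eqxx ?leq_addr.
have [h0 h0E] : {h0 | (b.+1 * size (blossoms (Primal a cs)) + maxn a 1 = h0.+1)%N}.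
  by exists (b.+1 * size (blossoms (Primal a cs)) + (maxn a 1).-1)%N; lia.
rewrite h0E height_Primal_leq; apply/allP => c cI; rewrite -ltnS -h0E.
have /andP[e cv] := csv c cI; apply: leq_ltn_trans (IH c cI cv).1 _.
have := size_flatten_geq nt cI; rewrite mul1n -/(blossoms (Primal a cs)) [size cs]/=.
case: cs0 @cs csb sum_cs cI {IH tv csv nt h0 h0E} => [|c1 cs0] /= csb sum_cs cI.
  (* Only child: a + a' = b + 1 and a' + a2 = b give a2 = a - 1. *)
  rewrite inE in cI; move/eqP in cI; subst c0.
  rewrite addn0 cats0 => _; move: (size _) => S.
  case: c e cv csb sum_cs => a' [a2 cs2|l ds] /= e cv csb sum_cs; last by lia.
  by move: e; rewrite /edge_ok /= => /and3P[_ a20 /eqP e]; rewrite ltn_add2l; lia.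
(* Several children: another one has a blossoming vertex, whose share b + 1 exceeds the arrow term
   of [c]. *)
move=> le; have : ((if c.2 is Primal a2 _ then maxn a2 1 else 0) <= b)%N.
  case: (c.2) cv => // a2 cs2; rewrite valid_Primal => /andP[/primal_ok_bounds[a2b _ _] _].
  by rewrite geq_max a2b.
move: (size (blossoms c.2)) (size (_ ++ _)) (if c.2 is Primal _ _ then _ else _) le.
move=> S tot x le xb; have : (b.+1 * S.+1 <= b.+1 * tot)%N.
  by rewrite leq_mul2l /= (leq_trans _ le) // addnS ltnS leq_addr.
rewrite mulnS; move: (b.+1 * S)%N (b.+1 * tot)%N => u v uv.
by rewrite -addnS addnC (leq_trans _ (leq_addr _ _)) // (leq_trans _ uv) // leq_add2r.
Qed.

Hypothesis b0 : (0 < b)%N.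

(* A tree with more height has a repeated number, hence weight zero. *)
Definition height_bound : nat := (b.+1 * n.+1)%N.

Lemma height_leq_bound (t : T) : valid t ->
  uniq [seq x.1 | x <- blossoms t] -> (height t <= height_bound)%N.
Proof.
move=> tv /card_uniqP; rewrite size_map => sz.
have [le _] := height_leq b0 tv; apply: leq_trans le _.
rewrite /height_bound mulnS addnC leq_add //.
  case: t tv {sz} => // a cs; rewrite valid_Primal => /andP[/primal_ok_bounds[ab _ _] _].
  by rewrite geq_max ltnW.
by rewrite leq_mul2l -sz -[X in (_ <= X)%N]card_ord max_card orbT.
Qed.

(** Recursions from height [h] to [h.+1] thereby become equations between series at a single
    height. *)
Lemma gf_stable h h' (p : pred T) : (height_bound <= h)%N -> (h <= h')%N -> gf h' p = gf h p.
Proof.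
move=> hb hh; rewrite /gf; apply/ffunP=> B; rewrite !mls_coef_sum.
rewrite (bigID (fun t => height t <= h)%N) /= [X in _ + X]big1_seq ?addr0; last first.
  move=> t /andP[/andP[_ ht]]; rewrite mem_trees => /andP[tv _]; rewrite wtE.
  case: uniq (@height_leq_bound t tv) => // /(_ isT) hb'.
  by rewrite (leq_trans hb' hb) in ht.
rewrite -big_filter -[RHS]big_filter; apply: perm_big.
apply: uniq_perm => [||t]; [exact/filter_uniq/trees_uniq..|].
rewrite !mem_filter !mem_trees -andbA; congr (_ && _).
rewrite andbCA; congr (_ && _); case: (leqP (height t) h) => // ht.
exact: leq_trans ht hh.
Qed.

Definition is_dual (t : T) : bool := if t is Dual _ _ then true else false.

Definition decoration_wt (d : option T) : A := if d is Some t then wt t else 1.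

Definition decorations (h : nat) : seq (option T) := None :: map Some (trees h).

Lemma gf_dual_sum h : gf h.+1 is_dual =
  \sum_l mlsX rat l * \sum_(ds <- words (2 * m l).-1 (decorations h) | valid (Dual l ds))
     \prod_(d <- ds) decoration_wt d.
Proof.
rewrite /gf treesS big_filter_cond big_cat /= [X in X + _]big_mkcond.
rewrite big_allpairs_dep [X in X + _]big1 ?add0r; last first.
  by move=> a _; apply: big1 => cs _; rewrite /= andbF.
rewrite big_mkcond big_allpairs_dep big_enum; apply: eq_bigr => l _.
rewrite mulr_sumr [RHS]big_mkcond; apply: eq_bigr => ds _; rewrite andbT.
by case: ifP => // _; rewrite wt_Dual.
Qed.

Lemma valid_Dual_special l ds : m l = b -> size ds = (2 * m l).-1 ->
  valid (Dual l ds) = all (@is_leaflet 'I_n) ds.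
Proof.
move=> mlb sz; have szS : (size ds).+1 = (2 * b)%N by rewrite sz mlb prednK // muln_gt0.
rewrite valid_Dual /dual_ok szS eqxx mlb eqxx /=.
case: allP => //= H; apply/andP; split; last first.
  by apply/allP => -[t|//] /H.
case: ds H {sz szS} => //= d ds H; elim: ds d H => //= d' ds IHds d H.
rewrite IHds ?andbT; last by move=> x xI; apply: H; rewrite inE xI orbT.
by case: d H => [t|] H //; have := H (Some t) (mem_head _ _).
Qed.

Lemma sum_words_special h N :
  \sum_(ds <- words N (decorations h) | all (@is_leaflet 'I_n) ds)
     \prod_(d <- ds) decoration_wt d = 1.
Proof.
transitivity (\sum_(ds <- words N (decorations h)) \prod_(d <- ds) (is_leaflet d)%:R : A).
  rewrite big_mkcond; apply: eq_bigr => ds _.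
  elim: ds => [|[t|] ds IHds]; rewrite !(big_nil, big_cons) //=; first by rewrite mul0r.
  by rewrite -IHds; case: all; rewrite ?mul1r ?mulr0.
by rewrite sum_words big_cons big_map big1_eq addr0 expr1n.
Qed.

Lemma is_twigE (t : T) : valid t -> is_twig (Some t) = (t == Primal 0 [::]).
Proof.
case: t => [[|a] cs|l ds] tv; last by apply/esym/negbTE/eqP.
  move: tv; rewrite valid_Primal => /andP[]; rewrite /primal_ok.
  by case: cs => [|c cs] /=; [move=> _ _; exact/esym/eqP|].
by apply/esym/negbTE/eqP => -[].
Qed.

Lemma valid_twig : valid (Primal 0 [::]).
Proof. by rewrite valid_Primal. Qed.

Lemma gf_twig h : (0 < h)%N -> gf h (fun t => is_twig (Some t)) = 1.
Proof.
move=> h0; rewrite /gf big_mkcond.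
rewrite (bigD1_seq (Primal 0 [::])) ?trees_uniq ?mem_trees ?valid_twig //.
rewrite big1_seq; first by rewrite /= /wt big_nil addr0.
move=> t /andP[/negbTE tn]; rewrite mem_trees => /andP[tv _].
by rewrite (is_twigE tv) tn.
Qed.

(** The degree [d] rules out the special bent type. If two dual vertices meet, then b = 1 and the
    lower one has degree 2, so its only decoration is a leaflet. *)
Lemma edge_ok_dual (t : T) d : valid t -> (2 * b + 2 <= d)%N ->
  edge_ok b (DualHalf d) (top_half t) = is_twig (Some t) || codes_0slice b t.
Proof.
move=> tv db; case: t tv => [a cs|l ds] tv /=; rewrite /edge_ok /=.
  rewrite [d == _]gtn_eqF ?andbF /= ?db ?andbT; last by lia.
  by case: a {tv}.
rewrite [d == _]gtn_eqF /=; last by lia.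
have [b1|] /= := eqVneq b 1%N; last by case: ds {tv} => [|[|] []].
move: tv; rewrite valid_Dual => /and4P[_ H _ _]; move: H.
by rewrite /dual_ok b1; case: ds => [|[t|] [|? ?]] //=.
Qed.

Hypothesis mb : forall l, (b <= m l)%N.

Lemma mem_decorations h ds N : ds \in words N (decorations h) ->
  size ds = N /\ (forall t, Some t \in ds -> t \in trees h).
Proof.
rewrite mem_words => /andP[/eqP sz /allP dsI]; split=> // t /dsI.
by rewrite inE => /mapP[t' t'I [->]].
Qed.

(* A 0-slice hangs from each attaching point, as [edge_ok_dual] shows. *)
Definition attaching (d : option T) : bool := if d is Some t then codes_0slice b t else false.

Lemma valid_Dual_regular h l ds : (b < m l)%N -> ds \in words (2 * m l).-1 (decorations h) ->
  valid (Dual l ds) =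
  [&& all (fun d => [|| is_leaflet d, is_twig d | attaching d]) ds,
      sorted (fun x y => ~~ (is_twig x && is_leaflet y)) ds
    & count (@is_twig 'I_n) ds == (m l - b.+1)%N].
Proof.
move=> ml /mem_decorations[sz dsI].
have szS : (size ds).+1 = (2 * m l)%N by rewrite sz prednK // muln_gt0 /= (leq_ltn_trans _ ml).
rewrite valid_Dual /dual_ok szS eqxx mul2n odd_double doubleK ml -mul2n.
rewrite [(2 * m l)%N == _]gtn_eqF /=; last by lia.
set C := count _ _ == _; set Z := sorted _ _.
suff -> : all (fun d => if d is Some t then edge_ok b (DualHalf (2 * m l)) (top_half t) && valid t
            else true) ds = all (fun d => [|| is_leaflet d, is_twig d | attaching d]) ds.
  by case: C; case: Z; case: all. 
apply: eq_in_all => -[t|//] tI /=.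
have tv : valid t by have := dsI t tI; rewrite mem_trees => /andP[].
by rewrite (edge_ok_dual tv) ?tv ?andbT //; lia.
Qed.

Lemma gf_dual h N : (0 < h)%N -> (forall l, m l + b < N)%N ->
  gf h.+1 is_dual =
  \sum_l mlsX rat l * mls_eval (gf h (codes_0slice b)) (qpoly b N (m l)).
Proof.
move=> h0 mN; rewrite gf_dual_sum; apply: eq_bigr => l _; congr (_ * _).
have q_eval : mls_eval (gf h (codes_0slice b)) (qpoly b N (m l)) =
    \sum_(k < N) mls_const 'I_n (q b k (m l)%:R) * gf h (codes_0slice b) ^+ k.
  rewrite (mls_evalE _ (size_poly _ _)); apply: eq_bigr => k _.
  by rewrite coef_poly ltn_ord.
have [ml|ml|ml] := ltngtP b (m l); last first.
(* Special vertex: the only word consists of leaflets, and only q_0 = 1 survives. *)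
- rewrite big_seq_cond.
  rewrite (eq_bigl (fun ds => (ds \in words (2 * m l).-1 (decorations h)) && all (@is_leaflet 'I_n) ds)).
    rewrite -big_seq_cond sum_words_special q_eval.
    have N0 : (0 < N)%N by apply: leq_ltn_trans (mN l).
    rewrite (bigD1 (Ordinal N0)) //= -ml q_diag expr0 mulr1 rmorph1.
    rewrite big1 ?addr0 // => -[[|k] kN] // _.
    by rewrite q_diag rmorph0 mul0r.
  move=> ds; case dsI: (_ \in _) => //=; have [sz _] := mem_decorations dsI.
  exact: valid_Dual_special.
- by have := mb l; rewrite leqNgt ml.
rewrite big_seq_cond (eq_bigl (fun ds => (ds \in words (2 * m l).-1 (decorations h)) &&
  [&& all (fun d => [|| is_leaflet d, is_twig d | attaching d]) ds,
      sorted (fun x y => ~~ (is_twig x && is_leaflet y)) ds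
    & count (@is_twig 'I_n) ds == (m l - b.+1)%N])); last first.
  by move=> ds; case dsI: (_ \in _) => //=; exact: (valid_Dual_regular ml dsI).
rewrite -big_seq_cond.
have -> : (2 * m l).-1 = (m l + b + (m l - b.+1))%N by lia.
rewrite (tight_words (R := gf h (codes_0slice b))).
- rewrite q_eval /tight_gf.
  rewrite (big_ord_widen _ (fun k => gf h (codes_0slice b) ^+ k *+
     ('C(m l + b, k) * 'C(m l - b.+1 + k, k))) (mN l)) big_mkcond.
  apply: eq_bigr => k _; rewrite q_nat // rmorph_nat mulr_natl.
  by case: ifP => // /negbT; rewrite -leqNgt => kl; rewrite bin_small.
- by case.
- by case.
- by case=> // -[[|a] cs|] //=; rewrite (ltn_eqF b0).
- by rewrite big_cons big_map /= big_pred0_eq addr0.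
- by rewrite big_cons big_map /= -[RHS](gf_twig h0).
- by rewrite big_cons big_map.
Qed.

(** Adding booleans as integers expresses a disjoint union. *)
Lemma gf_split h (p p1 p2 : pred T) :
  (forall t, valid t -> p t = p1 t + p2 t :> nat)%N -> gf h p = gf h p1 + gf h p2.
Proof.
move=> pE; rewrite /gf !(big_mkcond _ (fun t => wt t)) -big_split.
apply: eq_big_seq => t; rewrite mem_trees => /andP[/pE + _].
by case: (p t) (p1 t) (p2 t) => [] [] [] // _; rewrite /= ?addr0 ?add0r.
Qed.

Lemma eq_gf h (p p' : pred T) : (forall t, valid t -> p t = p' t) -> gf h p = gf h p'.
Proof.
move=> pE; rewrite /gf big_seq_cond [RHS]big_seq_cond; apply: eq_bigl => t.
by rewrite mem_trees; case: (boolP (valid t)) => // /pE ->.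
Qed.

Lemma gf_pred0 h : gf h pred0 = 0.
Proof. by rewrite /gf big_pred0_eq. Qed.

Definition is_special (t : T) : bool :=
  if t is Dual _ ds then (size ds).+1 == (2 * b)%N else false.

Lemma gf_if h (c : bool) (p : pred T) :
  gf h (fun t => c && p t) = if c then gf h p else 0.
Proof. by case: c => /=; [apply: eq_gf|rewrite (@eq_gf _ _ pred0) ?gf_pred0]. Qed.

Lemma gf_beyond h a : (0 < a < b)%N ->
  gf h (beyond a) = gf h (top_primal (b - a)) + (if a.+1 == b then gf h is_special else 0).
Proof.
move=> /andP[a0 ab]; rewrite -gf_if; apply: gf_split => -[a' cs|l ds] _; rewrite /beyond /edge_ok /=.
  by rewrite a0 andbF addn0; congr nat_of_bool; lia.
by rewrite add0n; congr nat_of_bool; lia.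
Qed.

(** A degree 2 m_l with b <= m_l is 2 b or at least 2 b + 2. No primal half-edge may follow one with
    [b] arrows, since both carry arrows and their total is [b]. *)
Lemma gf_beyond_b h : gf h is_dual = gf h (beyond b) + gf h is_special.
Proof.
apply: gf_split => -[a' cs|l ds] tv; rewrite /beyond /edge_ok /=.
  by rewrite addn0; lia.
move: tv; rewrite valid_Dual => /and4P[/eqP -> _ _ _]; have := mb l; lia.
Qed.

Lemma gf_codes h : gf h (codes_0slice b) =
  gf h (top_primal b) + (if (1 == b)%N then gf h is_special else 0).
Proof.
rewrite -gf_if; apply: gf_split => -[a' cs|l ds] tv /=; first by rewrite andbF addn0.
rewrite add0n eq_sym; congr nat_of_bool; have [b1|b1] /= := eqVneq b 1%N; last first.
  by case: ds {tv} => [|[|] []] //=; apply/negbTE.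
move: tv; rewrite valid_Dual => /and4P[_ H _ _]; move: H.
by rewrite /dual_ok b1; case: ds => [|[t|] [|? ?]].
Qed.

(** The series [U] below obey the recursion of [narayana], from [U 0 = R] up to [U b], the series of
    all dual vertices; [mulX_alpha_den] recognizes the resulting polynomial. *)
Lemma functional_equation h N : (height_bound <= h)%N -> (forall l, m l + b < N)%N ->
  mls_eval (gf h (codes_0slice b)) ('X * alpha_den b) =
  \sum_l mlsX rat l * mls_eval (gf h (codes_0slice b)) (qpoly b N (m l)).
Proof.
move=> hb mN; have h0 : (0 < h)%N by apply: leq_trans hb; rewrite muln_gt0.
rewrite -(gf_dual h0 mN) (gf_stable _ hb (leqnSn h)).
set R := gf h (codes_0slice b); set S := gf h is_special.
pose H a := gf h (beyond a).
pose U a := if a == 0%N then R else H a + (if a == b then S else 0).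
pose W := \sum_(j < b.+2) beyond_poly h ^+ j.
have HE a : (a < b)%N -> (beyond_poly h)`_a.+1 = H a.+1 by move=> ab; rewrite coef_poly ltnS ab.
have H0 : (beyond_poly h)`_0 = 0 by rewrite coef_poly.
have W0 : W`_0 = 1.
  rewrite /W big_ord_recl coefD coef1 coef_sum big1 ?addr0 // => i _.
  by rewrite lift0 coef_exp_low.
have WP a : (a < b)%N -> W`_a.+1 = gf h (top_primal (b - a)).
  move=> ab; rewrite -(gf_stable _ hb (leqnSn h)) gf_primal; last by lia.
  by congr (_`__); lia.
(* Up to [S], [U a] counts trees whose top half-edge carries b - a arrows, which leaves a + 1 arrows
   for the children. *)
have UW a : (a < b)%N -> U a = W`_a.+1 + (if a.+1 == b then S else 0).
  move=> ab; rewrite WP //; case: a ab => [|a] ab; first by rewrite /U eqxx subn0 -gf_codes.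
  by rewrite /U /= ltn_eqF // addr0 /H gf_beyond.
have UH a : (a < b)%N -> U a.+1 = H a.+1 + (if a.+1 == b then S else 0) by [].
(* The corrections by [S] occur on both sides when a + 1 = b, and cancel; the indices inside the sum
   are too small to involve [S]. *)
have UE a : (a < b)%N -> U a.+1 = U a - \sum_(i < a) U i.+1 * U (a - i.+1)%N.
  move=> ab; apply: (canRL (addrK _)); rewrite UH // UW // addrAC; congr (_ + _).
  rewrite geometric_coefS //; last exact: leqW.
  rewrite big_ord_recr /= subnn W0 mulr1 HE // addrC; congr (_ + _).
  apply: eq_bigr => i _; have ia := ltn_ord i; rewrite HE; last by lia.
  rewrite UH; last by lia.
  rewrite UW; last by lia.
  by rewrite !ifF ?addr0 ?subnSK //; lia.
have := narayana b0 UE.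
have -> : U 0%N = R by [].
have <- : mls_eval R ('X * alpha_den b) *+ b =
    \sum_(i < b) R ^+ i.+1 * (-1) ^+ i *+ ('C(b, i.+1) * 'C(b, i)).
  rewrite -rmorphMn mulX_alpha_den // rmorph_sum; apply: eq_bigr => i _.
  by rewrite rmorphMn rmorphM !rmorphXn rmorphN1 /= mls_evalX.
have -> : b`! = (b * (b.-1)`!)%N by case: b b0 => // ? _; rewrite factS.
rewrite mulrnA => /mls_mulrnI /(_ (fact_gt0 _)) /mls_mulrnI /(_ b0) <-.
rewrite gf_beyond_b /U eqxx; case: eqP => // e; by move: b0; rewrite e.
Qed.
End Trees.

(** * Counting forests *)

Section Marking.
Variables (I : finType) (K : comNzRingType) (i0 : I).

(** The derivation t_i0 d/dt_i0. *)
Definition mark (f : mls I K) : mls I K := [ffun B : {set I} => f B *+ (i0 \in B)].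

Lemma markM f g : mark (f * g) = mark f * g + f * mark g.
Proof.
apply/ffunP=> B; rewrite mlsD ffunE !mlsM -big_split -sumrMnl; apply: eq_bigr => C CB /=.
rewrite !ffunE mulrnAl mulrnAr -mulrnDr; congr (_ *+ _).
by rewrite inE; case: (boolP (i0 \in C)) => [/(subsetP CB) ->|].
Qed.

Lemma markX f k : mark (f ^+ k.+1) = (mark f * f ^+ k) *+ k.+1.
Proof.
elim: k => [|k IHk]; first by rewrite expr1 mulr1.
by rewrite exprS markM IHk mulrnAr mulrCA -exprS -mulrS.
Qed.
End Marking.

Section Forests.
Variables (n b k : nat) (m : 'I_n -> nat).
Hypotheses (n0 : (0 < n)%N) (b0 : (0 < b)%N) (mb : forall l, (b <= m l)%N).
Local Notation T := (tree 'I_n).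

Let i0 : 'I_n := Ordinal n0.
Let h := height_bound n b.

Definition slices : seq T := [seq t <- trees b m h | codes_0slice b t].

Definition has_first (t : T) : bool := has (fun x => val x.1 == 0%N) (blossoms t).

Definition covers (w : seq T) : bool :=
  perm_eq (flatten [seq blossoms t | t <- w]) [seq (i, (2 * m i)%N) | i <- enum 'I_n].

Definition forests : seq (seq T) :=
  [seq w <- words k.+1 slices | covers w && (if w is t :: _ then has_first t else false)].

Lemma mem_slices t : (t \in slices) =
  [&& codes_0slice b t, valid b m t & (height t <= h)%N].
Proof. by rewrite mem_filter mem_trees. Qed.

Lemma codes_0slice_blossoms t : codes_0slice b t -> valid b m t -> (0 < size (blossoms t))%N.
Proof.
move=> ct tv; apply: (height_leq b0 tv).2.
by case: t ct {tv} => [[|a] cs|l ds] //= /eqP e; move: b0; rewrite -e.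
Qed.

Lemma gf_codes_set0 : gf b m h (codes_0slice b) set0 = 0.
Proof.
rewrite /gf mls_coef_sum big1_seq // => t /andP[ct]; rewrite mem_trees => /andP[tv _].
have := codes_0slice_blossoms ct tv; rewrite wtE; case: (blossoms t) => // x s _.
case: eqP => [/setP/(_ x.1)|]; last by rewrite andbF.
by rewrite !inE eqxx.
Qed.

(** The top coefficient requires each number to occur exactly once; validity already ties the degree
    to the number. *)
Lemma covers_wt w : all (valid b m) w ->
  (\prod_(t <- w) wt t) [set: 'I_n]%SET = (covers w)%:R.
Proof.
move=> wv; set g := fun i : 'I_n => (i, (2 * m i)%N).
have -> : \prod_(t <- w) wt t =
    \prod_(i <- [seq x.1 | x <- flatten [seq blossoms t | t <- w]]) mlsX rat i.
  by rewrite big_map big_flatten big_map.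
rewrite prod_mlsX /covers; set u := map _ _.
have -> : flatten [seq blossoms t | t <- w] = [seq g i | i <- u].
  rewrite -map_comp -[LHS]map_id; apply/eq_in_map => -[l d] /flatten_mapP[t tw xt].
  have /allP/(_ t tw)/and3P[_ _ /allP/(_ _ xt) /eqP /= ->] := wv.
  by [].
have -> : perm_eq [seq g i | i <- u] [seq g i | i <- enum 'I_n] = perm_eq u (enum 'I_n).
  by apply/idP/idP => [/perm_map_inj->//|/perm_map//]; move=> i j [].
congr (nat_of_bool _)%:R; apply/andP/idP => [[uu /eqP /setP uT]|pu].
  apply: uniq_perm => //; first exact: enum_uniq.
  by move=> i; have := uT i; rewrite !inE mem_enum => <-.
split; first by rewrite (perm_uniq pu) enum_uniq.
by apply/eqP/setP => i; rewrite !inE (perm_mem pu) mem_enum.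
Qed.

Lemma mark_wt t : mark i0 (wt t) = wt t *+ has_first t.
Proof.
apply/ffunP=> B; rewrite ffunE.
rewrite mlsMn wtE; case: (boolP (_ && _)) => [/andP[_ /eqP->]|_]; last by rewrite !mul0rn.
congr (_ *+ nat_of_bool _); rewrite inE /has_first.
apply/mapP/hasP => [[x xt xi]|[x xt /eqP xi]]; exists x => //.
  by rewrite -xi.
by apply/val_inj; rewrite /= xi.
Qed.

(** On the full set [mark] changes nothing, while applied to R^(k+1) it gives k + 1 times the series
    of forests whose first tree has the marked vertex. *)
Lemma natr_size_forests :
  ((size forests)%:R : rat) *+ k.+1 = (gf b m h (codes_0slice b) ^+ k.+1) [set: 'I_n].
Proof.
set R := gf b m h (codes_0slice b).
have markE : mark i0 R = \sum_(t <- slices) wt t *+ has_first t.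
  rewrite /R /gf -big_filter -/slices; elim: slices => [|t s IHs].
    by rewrite !big_nil; apply/ffunP=> B; rewrite !ffunE mul0rn.
  rewrite !big_cons -IHs -mark_wt; apply/ffunP=> B.
  by rewrite mlsD !ffunE mulrnDl.
have -> : (R ^+ k.+1) [set: 'I_n] = mark i0 (R ^+ k.+1) [set: 'I_n] by rewrite ffunE inE.
rewrite markX mlsMn; congr (_ *+ _).
have RE : R = \sum_(t <- slices) wt t by rewrite /R /gf -big_filter.
rewrite markE RE -sum_words big_distrlr /= mls_coef_sum.
rewrite /forests size_filter -sum1_count natr_sum big_mkcond big_allpairs_dep.
apply: eq_big_seq => t ts; rewrite mls_coef_sum; apply: eq_big_seq => w.
rewrite mem_words => /andP[_ /allP ws].
rewrite mulrnAl mlsMn; have -> : wt t * \prod_(x <- w) wt x = \prod_(x <- t :: w) wt x by rewrite big_cons.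
rewrite covers_wt; last first.
  apply/allP => t'; rewrite inE => /orP[/eqP->|/ws].
    by move: ts; rewrite mem_slices => /and3P[].
  by rewrite inE mem_slices => /and3P[].
by case: covers => /=; case: has_first.
Qed.

End Forests.

From mathcomp Require Import classical_sets functions cardinality fsbigop.

(** * Extraction of the coefficient, and the final count *)

Section Count.
Variables (n b k : nat) (m : 'I_n -> nat).
Hypotheses (n0 : (0 < n)%N).

(** Expanding the product gives the families bounded by [N]; any other has total at least [n], where
    [alpha] vanishes. The [n] inverse factors, one per vertex, make up the exponent (n - 1) + 1 in
    [alpha]. *)
Lemma F_coef N : (n <= N)%N ->
  F b k n m = (n.-1)`!%:R *
     ('X^k * \prod_l (qpoly b N (m l) * trunc_inv n (alpha_den b)))`_n.-1.
Proof.
move=> nN; rewrite /F; congr (_ * _).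
pose emb (f : {ffun 'I_n -> 'I_N}) : {ffun 'I_n -> nat} := [ffun i => val (f i)].
have emb_inj : injective emb.
  by move=> f g /ffunP fg; apply/ffunP=> i; apply/val_inj; have := fg i; rewrite !ffunE.
set G := fun ks : {ffun 'I_n -> nat} => _ * _.
have phi0 : (alpha_den b)`_0 = 1 by rewrite -[alpha_den b]expr1 alpha_den_coef0.
transitivity (\sum_(f : {ffun 'I_n -> 'I_N}) G (emb f)); last first.
  rewrite big_split /= prodr_const card_ord /qpoly.
  under [X in _ * (X * _)]eq_bigr => l _ do rewrite poly_def.
  rewrite bigA_distr_bigA /= mulrA mulr_sumr mulr_suml coef_sum.
  apply: eq_bigr => f _; rewrite /G.
  have -> : \prod_i (q b (f i) (m i)%:R *: 'X^(f i)) =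
     (\prod_i q b (f i) (m i)%:R) *: 'X^(\sum_i f i) :> {poly rat}.
    by rewrite scaler_prod -(big_morph _ (exprD 'X) (expr0 'X)).
  rewrite -scalerAr -scalerAl coefZ -exprD coefXnM /alpha.
  have -> : (\sum_i emb f i = \sum_i f i)%N by apply: eq_bigr => i _; rewrite ffunE.
  congr (_ * _); first by apply: eq_bigr => i _; rewrite ffunE.
  rewrite ltnNge; case: leqP => //= le.
  by rewrite trunc_inv_exp // ?prednK // (leq_trans (leq_subr _ _)) // leq_pred.
rewrite (fsbigE (map emb (index_enum _))).
- rewrite big_map; apply: eq_bigl => f; exact: in_setT.
- by rewrite map_inj_uniq // index_enum_uniq.
- by [].
- move=> ks _ ksN; rewrite /G /alpha.
  have [i iN] : exists i, (N <= ks i)%N.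
    apply/existsP; apply: contraR ksN; rewrite negb_exists => /forallP ksN.
    have ksN' i : (ks i < N)%N by have := ksN i; rewrite -ltnNge.
    apply/mapP; exists [ffun i => Ordinal (ksN' i)]; first by rewrite mem_index_enum.
    by apply/ffunP=> i; rewrite !ffunE.
  rewrite ifF ?mulr0 //; apply/negbTE; rewrite -ltnNge.
  rewrite (bigD1 i) //= (@leq_trans N) //; first by rewrite (leq_trans _ nN) // prednK.
  by rewrite addnCA (leq_trans iN) // leq_addr.
Qed.

Lemma mls_exp_top (N : nat) (R : mls 'I_n rat) : (0 < b)%N -> (n <= N)%N ->
  R finset.set0 = 0 ->
  mls_eval R ('X * alpha_den b) = \sum_l mlsX rat l * mls_eval R (qpoly b N (m l)) ->
  (R ^+ k.+1) [set: 'I_n]%SET = F b k n m *+ k.+1.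
Proof.
move=> b0 nN R0 RE.
have phi0 : (alpha_den b)`_0 = 1 by rewrite -[alpha_den b]expr1 alpha_den_coef0.
have := @lagrange _ _ (fun l => qpoly b N (m l) * trunc_inv n (alpha_den b)) R k.
rewrite card_ord => /(_ n0) -> //; first by rewrite (F_coef nN) mulnC mulrnA mulr_natl.
(* Dividing by [alpha_den] puts the equation in Lagrange form; truncating the inverse at degree [n]
   is harmless because [R] has no constant term. *)
transitivity (mls_eval R ('X * alpha_den b * trunc_inv n (alpha_den b))).
  rewrite -[LHS]mls_evalX; apply: mls_eval_low; rewrite ?card_ord // => i le.
  rewrite -mulrA -[in LHS](mulr1 'X); apply: (coef_mul_low (n := n)) => // j jn.
  by rewrite trunc_invP ?phi0 ?oner_neq0 // coef1.
rewrite rmorphM /= RE mulr_suml; apply: eq_bigr => l _.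
by rewrite rmorphM mulrA.
Qed.
End Count.

Lemma card_eq_seq (T : eqType) (s : seq T) : uniq s -> ([set` s] #= `I_(size s))%card.
Proof.
move=> us; case s0: s => [|x0 s']; first by rewrite set_nil II0 card_eq0 eqxx.
rewrite -s0 {s0 s'}.
have -> : [set` s]%classic = (nth x0 s @` `I_(size s))%classic.
  apply/seteqP; split=> x /= => [xs|[i il <-]]; last exact: mem_nth.
  by exists (index x s); [rewrite /= index_mem|rewrite nth_index].
apply: inj_card_eq => i j; rewrite !inE /= => il jl /eqP.
by rewrite nth_uniq // => /eqP.
Qed.

Theorem proposition3p8 (n b k : nat) (m : 'I_n -> nat) :
  (1 <= n)%N -> (1 <= b)%N -> (forall i, (b <= m i)%N) ->
  (exists N : nat,
     ([set ts : k.+1.-tuple (tree 'I_n) | slice_forest b m ts]%classic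
        #= `I_N)%card /\
     N%:R = F b k n m)
  /\ (forall (j : nat) (x : rat),
        q b j x = (j`!%:R ^+ 2)^-1 *
                  \prod_(i < j) (x ^+ 2 - (b%:R - i%:R) ^+ 2)).
Proof.
move=> n0 b0 mb; split; last by move=> j x; exact: q_prod.
exists (size (forests b k m)); split; last first.
  (* [N] has to exceed every m_l + b, for the decorations, and to be at least [n], for [F_coef]. *)
  pose N := (\sum_l m l + b + n).+1.
  have mN l : (m l + b < N)%N.
    by rewrite /N ltnS (bigD1 l) //= -!addnA leq_add2l; lia.
  have := functional_equation b0 mb (leqnn _) mN.
  move=> /(mls_exp_top k n0 b0 _ (gf_codes_set0 m b0)) E.
  have /E {E} : (n <= N)%N by rewrite /N; lia.
  by rewrite -natr_size_forests // => /(pmulrnI (ltn0Sn k)).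
have fu : uniq (forests b k m).
  exact/filter_uniq/words_uniq/filter_uniq/trees_uniq.
apply: card_eq_trans (card_eq_seq fu); rewrite card_eq_sym.
have -> : [set` forests b k m]%classic =
    (val @` [set ts : k.+1.-tuple (tree 'I_n) | slice_forest b m ts])%classic.
  apply/seteqP; split=> w /=.
    rewrite mem_filter mem_words => /andP[/andP[cw hw] /andP[sw /allP ws]].
    exists (Tuple sw) => //; split=> //=.
    - apply/allP => t /ws; rewrite inE mem_slices => /and3P[ct /and3P[-> -> _] _].
      by rewrite ct.
    - by case: w sw hw {cw ws} => // t w sw hw; rewrite /thead (tnth_nth t).
  case=> ts [/allP tsv cts hts] <- /=.
  rewrite mem_filter mem_words size_tuple eqxx; apply/andP; split.
    apply/andP; split; first exact: cts.
    by case: (tupleP ts) hts => t u; rewrite theadE.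
  have perm_blossoms := perm_map fst cts.
  apply/allP => t tts; rewrite inE mem_slices; have /and3P[dt ct tt] := tsv t tts.
  have sub x : x \in blossoms t -> x \in flatten [seq blossoms t | t <- ts].
    by move=> xt; apply/flatten_mapP; exists t.
  have tv : valid b m t.
    rewrite /valid dt tt; apply/allP => x /sub; rewrite (perm_mem cts).
    by case/mapP => i _ ->.
  (* The numbers are distinct in the whole forest, hence in [t], which bounds its height. *)
  rewrite ct tv; apply: (height_leq_bound b0 tv).
  have : uniq [seq x.1 | x <- flatten [seq blossoms t | t <- ts]].
    by rewrite (perm_uniq perm_blossoms) -map_comp map_id enum_uniq.
  have /perm_to_rem p := tts.
  rewrite (perm_uniq (perm_map fst (perm_flatten (perm_map _ p)))) /= map_cat cat_uniq.
  by case/andP.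
apply: inj_card_eq => x y _ _; exact: val_inj.
Qed.
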